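(* Consider the theory in the language $\{\times,{}^{-1},\mathbf 0,\mathbf 1,\mathbf{-1},\mathcal P\}$ with the following axioms, where $n$ ranges over all natural numbers $n\geq 1$: (M$_1$) $\forall x,y,z\,(x\cdot(y\cdot z)=(x\cdot y)\cdot z)$; (M$_2$) $\forall x\,(x\cdot\mathbf 1=x)$; (M$_3$) $\forall x\,(x\neq\mathbf 0\rightarrow x\cdot x^{-1}=\mathbf 1)$; (M$_4$) $\forall x,y\,(x\cdot y=y\cdot x)$; (M$_9^\diamond$) $\exists y\,(y\neq\mathbf{-1}\wedge y\neq\mathbf 0\wedge y\neq\mathbf 1)$; (M$_{10}$) $\forall x\,(x\cdot\mathbf 0=\mathbf 0=\mathbf 0^{-1})$; (M$_{11,n}$) $\forall x\,(x^{2n}=\mathbf 1\leftrightarrow x=\mathbf 1\vee x=\mathbf{-1})$; (M$_{12,n}$) $\forall x\,\exists y\,(x=y^{2n+1})$; (M$_{13}$) $\forall x\,(\mathcal P(x)\leftrightarrow\exists y[y\neq\mathbf 0\wedge x=y^2])$; (M$_{14}$) $\forall x\,(x\neq\mathbf 0\rightarrow[\neg\mathcal P(x)\leftrightarrow\mathcal P(-x)])$; (M$_{15}$) for all $x,y\neq\mathbf 0$: $\mathcal P(x\cdot y)\leftrightarrow[\mathcal P(x)\leftrightarrow\mathcal P(y)]$. This theory completely axiomatizes the structure $\langle\mathbb R;\times,{}^{-1},\mathbf 0,\mathbf 1,\mathbf{-1},\mathcal P\rangle$ and, moreover, its theory admits quantifier elimination, and so is decidable.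
   Context: In $\mathbb R$, $\mathcal P(y)$ means that $y$ is a positive real number, ${}^{-1}$ is the multiplicative inverse on nonzero elements, and by convention $0^{-1}=0$. $-x$ is a shorthand for $(\mathbf{-1})\cdot x$, and $x^n$ abbreviates $x\cdot x\cdots x$ ($n$ times). The symbols $\times$ and $\cdot$ are used interchangeably. A theory completely axiomatizes a structure if, for every first-order sentence of the language of the structure, the sentence is true in the structure if and only if it is provable from the theory. Quantifier elimination means that every formula of the language is equivalent, modulo the theory, to a quantifier-free formula of that language. A theory is decidable if there is an algorithm deciding whether a given sentence belongs to it. *)

(* Defs.v *)
From mathcomp Require Import all_boot all_order all_algebra.
From mathcomp Require Import reals.

Set Implicit Arguments.
Unset Strict Implicit.
Unset Printing Implicit Defensive.

(* Variables are de Bruijn indices; equality is part of the logic. *)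

Inductive term : Type :=
| Var of nat
| Zero
| One
| MOne
| Mul of term & term
| Inv of term.

Inductive formula : Type :=
| Bot
| Eq of term & term
| Pos of term
| Imp of formula & formula
| All of formula.

(* The other logical constants are the usual classical abbreviations. *)
Definition Neg A := Imp A Bot.
Definition And A B := Neg (Imp A (Neg B)).
Definition Or A B := Imp (Neg A) B.
Definition Iff A B := And (Imp A B) (Imp B A).
Definition Ex A := Neg (All (Neg A)).

(* For k >= 1 this is the product of exactly k factors t, with no trailing 1. *)
Definition Pow (t : term) (k : nat) : term := iterop k Mul t One.

Definition Opp (t : term) : term := Mul MOne t.

Declare Scope fo_scope.
Delimit Scope fo_scope with fo.
Bind Scope fo_scope with term formula.
Notation "s *' t" := (Mul s t) (at level 40, left associativity) : fo_scope.
Notation "s =' t" := (Eq s t) (at level 70, no associativity) : fo_scope.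
Notation "s <>' t" := (Neg (Eq s t)) (at level 70, no associativity) : fo_scope.
Notation "~' A" := (Neg A) (at level 75, right associativity) : fo_scope.
Notation "A /\' B" := (And A B) (at level 80, right associativity) : fo_scope.
Notation "A \/' B" := (Or A B) (at level 85, right associativity) : fo_scope.
Notation "A ->' B" := (Imp A B) (at level 99, right associativity) : fo_scope.
Notation "A <->' B" := (Iff A B) (at level 95, no associativity) : fo_scope.

Fixpoint tbounded (n : nat) (t : term) : bool :=
  match t with
  | Var i => i < n
  | Zero | One | MOne => true
  | Mul s t => tbounded n s && tbounded n t
  | Inv t => tbounded n t
  end.

(* All free variables of the formula have index < n. *)
Fixpoint bounded (n : nat) (A : formula) : bool :=
  match A with
  | Bot => true
  | Eq s t => tbounded n s && tbounded n t
  | Pos t => tbounded n t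
  | Imp A B => bounded n A && bounded n B
  | All A => bounded n.+1 A
  end.

Definition sentence (A : formula) : bool := bounded 0 A.

Fixpoint quantifier_free (A : formula) : bool :=
  match A with
  | Bot | Eq _ _ | Pos _ => true
  | Imp A B => quantifier_free A && quantifier_free B
  | All _ => false
  end.

Fixpoint tsubst (sigma : nat -> term) (t : term) : term :=
  match t with
  | Var i => sigma i
  | Zero => Zero
  | One => One
  | MOne => MOne
  | Mul s t => Mul (tsubst sigma s) (tsubst sigma t)
  | Inv t => Inv (tsubst sigma t)
  end.

Definition scons {X : Type} (x : X) (f : nat -> X) (i : nat) : X :=
  if i is j.+1 then f j else x.

Definition shift (i : nat) : term := Var i.+1.

Fixpoint subst (sigma : nat -> term) (A : formula) : formula :=
  match A with
  | Bot => Bot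
  | Eq s t => Eq (tsubst sigma s) (tsubst sigma t)
  | Pos t => Pos (tsubst sigma t)
  | Imp A B => Imp (subst sigma A) (subst sigma B)
  | All A => All (subst (scons (Var 0) (fun i => tsubst shift (sigma i))) A)
  end.

Definition inst (A : formula) (t : term) : formula := subst (scons t Var) A.

Definition theory := formula -> Prop.

(* In prv_allI, shifting the hypotheses makes index 0 a fresh eigenvariable.  *)
Inductive prv : theory -> formula -> Prop :=
| prv_hyp (T : theory) A : T A -> prv T A
| prv_impI (T : theory) A B :
    prv (fun C => T C \/ C = A) B -> prv T (Imp A B)
| prv_impE (T : theory) A B : prv T (Imp A B) -> prv T A -> prv T B
| prv_raa (T : theory) A : prv (fun C => T C \/ C = Neg A) Bot -> prv T A
| prv_allI (T : theory) A :
    prv (fun C => exists2 B, T B & C = subst shift B) A -> prv T (All A)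
| prv_allE (T : theory) A t : prv T (All A) -> prv T (inst A t)
| prv_refl (T : theory) t : prv T (Eq t t)
| prv_leibniz (T : theory) A s t :
    prv T (Eq s t) -> prv T (inst A s) -> prv T (inst A t).

Record structure : Type := Structure {
  dom :> Type;
  zeroI : dom;
  oneI : dom;
  moneI : dom;
  mulI : dom -> dom -> dom;
  invI : dom -> dom;
  posI : dom -> Prop
}.

Fixpoint teval (M : structure) (e : nat -> M) (t : term) : M :=
  match t with
  | Var i => e i
  | Zero => zeroI M
  | One => oneI M
  | MOne => moneI M
  | Mul s t => mulI (teval e s) (teval e t)
  | Inv t => invI (teval e t)
  end.

Fixpoint sat (M : structure) (e : nat -> M) (A : formula) : Prop :=
  match A with
  | Bot => False
  | Eq s t => teval e s = teval e t
  | Pos t => posI (teval e t)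
  | Imp A B => sat e A -> sat e B
  | All A => forall x : M, sat (scons x e) A
  end.

Definition true_in (M : structure) (A : formula) : Prop :=
  forall e : nat -> M, sat e A.

Definition Th (M : structure) : theory := fun A => sentence A /\ true_in M A.

Definition theorems (T : theory) : theory := fun A => sentence A /\ prv T A.

Definition completely_axiomatizes (T : theory) (M : structure) : Prop :=
  forall A : formula, sentence A -> (true_in M A <-> prv T A).

Definition admits_QE (T : theory) : Prop :=
  forall (n : nat) (A : formula), bounded n A ->
  exists B : formula,
    [/\ quantifier_free B, bounded n B & prv T (Iff A B)].

(* The class generated from the initial functions by composition, primitive   *)
(* recursion and minimization of regular functions.  As functions into [bool] *)
(* exist for every predicate in classical logic, decidability has to refer to *)
(* such a class and not to the existence of a Rocq function.                  *)
Inductive recursive : forall n : nat, (n.-tuple nat -> nat) -> Prop :=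
| rec_zero n : recursive (fun _ : n.-tuple nat => 0)
| rec_succ : recursive (fun v : 1.-tuple nat => (thead v).+1)
| rec_proj n (i : 'I_n) : recursive (fun v : n.-tuple nat => tnth v i)
| rec_comp m n (h : m.-tuple nat -> nat) (g : 'I_m -> n.-tuple nat -> nat) :
    recursive h -> (forall i, recursive (g i)) ->
    recursive (fun v : n.-tuple nat => h [tuple g i v | i < m])
| rec_prec n (g : n.-tuple nat -> nat) (h : n.+2.-tuple nat -> nat)
    (f : n.+1.-tuple nat -> nat) :
    recursive g -> recursive h ->
    (forall v : n.-tuple nat, f [tuple of 0 :: v] = g v) ->
    (forall k (v : n.-tuple nat),
       f [tuple of k.+1 :: v] = h [tuple of k :: f [tuple of k :: v] :: v]) ->
    recursive f
| rec_mu n (h : n.+1.-tuple nat -> nat) (f : n.-tuple nat -> nat) :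
    recursive h ->
    (forall v : n.-tuple nat, h [tuple of f v :: v] = 0) ->
    (forall (v : n.-tuple nat) k, k < f v -> h [tuple of k :: v] <> 0) ->
    recursive f.

(* Cantor pairing. *)
Definition cpair (m n : nat) : nat := ((m + n) * (m + n).+1)./2 + n.

Fixpoint tcode (t : term) : nat :=
  match t with
  | Var i => cpair 0 i
  | Zero => cpair 1 0
  | One => cpair 2 0
  | MOne => cpair 3 0
  | Mul s t => cpair 4 (cpair (tcode s) (tcode t))
  | Inv t => cpair 5 (tcode t)
  end.

Fixpoint code (A : formula) : nat :=
  match A with
  | Bot => cpair 0 0
  | Eq s t => cpair 1 (cpair (tcode s) (tcode t))
  | Pos t => cpair 2 (tcode t)
  | Imp A B => cpair 3 (cpair (code A) (code B))
  | All A => cpair 4 (code A)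
  end.

Definition decidable_theory (T : theory) : Prop :=
  exists2 f : 1.-tuple nat -> nat, recursive f &
  forall A : formula, sentence A ->
    (T A /\ f [tuple code A] = 1) \/ (~ T A /\ f [tuple code A] = 0).

(* In a prefix "forall x, y, z" the variable z has index 0 and x the highest. *)
Inductive axM : theory :=
| M1 : axM (All (All (All
    (Var 2 *' (Var 1 *' Var 0) =' (Var 2 *' Var 1) *' Var 0))))%fo
| M2 : axM (All (Var 0 *' One =' Var 0))%fo
| M3 : axM (All (Var 0 <>' Zero ->' Var 0 *' Inv (Var 0) =' One))%fo
| M4 : axM (All (All (Var 1 *' Var 0 =' Var 0 *' Var 1)))%fo
| M9 : axM (Ex (Var 0 <>' MOne /\' Var 0 <>' Zero /\' Var 0 <>' One))%fo
| M10 : axM (All (Var 0 *' Zero =' Zero /\' Zero =' Inv Zero))%fo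
| M11 n : 1 <= n ->
    axM (All (Pow (Var 0) (2 * n) =' One <->'
              Var 0 =' One \/' Var 0 =' MOne))%fo
| M12 n : 1 <= n -> axM (All (Ex (Var 1 =' Pow (Var 0) (2 * n + 1))))%fo
| M13 : axM (All (Pos (Var 0) <->'
                  Ex (Var 0 <>' Zero /\' Var 1 =' Pow (Var 0) 2)))%fo
| M14 : axM (All (Var 0 <>' Zero ->'
                  (~' Pos (Var 0) <->' Pos (Opp (Var 0)))))%fo
| M15 : axM (All (All (Var 1 <>' Zero /\' Var 0 <>' Zero ->'
                  (Pos (Var 1 *' Var 0) <->'
                   (Pos (Var 1) <->' Pos (Var 0))))))%fo.

(* The field inverse of MathComp satisfies 0^-1 = 0 (invr0). *)
Definition real_structure (R : realType) : structure :=
  @Structure R 0%R 1%R (-1)%R (fun x y => x * y)%R (fun x => x^-1)%R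
             (fun x => (0 < x)%R).

(* Main.v *)
Require Import Defs.
From HB Require Import structures.
From mathcomp Require Import all_boot all_order all_algebra.
From mathcomp Require Import reals.
From mathcomp Require Import boolp.
From mathcomp Require Import zify.
From Stdlib Require List.
Set Implicit Arguments.
Unset Strict Implicit.
Unset Printing Implicit Defensive.
Import Order.TTheory GRing.Theory Num.Theory.

(** Why the theorem holds.

    In a model of the axioms the positive elements form a group P, by the axioms
    on the predicate, and every nonzero element is an element of P or the opposite
    of one.  P is torsion-free because 1 and -1 are the only roots of unity of even
    order, it is divisible because odd roots exist and because its elements are
    squares, and it is nontrivial because there is an element besides -1, 0, 1.
    Written additively, P is a nonzero rational vector space V, and the model is
    the structure [signed V] of zero and the signed elements of V
    ([model_signed]).

    In [signed V] a term is zero or has a sign and, as its exponent, an integer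
    combination of the exponents of the variables.  Hence a formula with free
    variables can only see the signs of their values and which linear relations
    hold between the exponents; with d quantifiers to go only coefficients up to
    some bound B(d) matter ([linsim]).  This is shown by a back-and-forth game
    ([game_back], [game_forth]): a new element either solves an equation
    k x + l = 0 with small k, and then so does its answer, or it solves none, and
    then a generic answer exists because V is infinite.  Two small relations for x
    eliminate to one relation with coefficients at most 2 B(d)^2, whence
    B(d+1) >= 2 B(d)^2.

    The game is played between a model and [signed int], where the answers can
    be found among finitely many elements: if in the round that leaves d quantifiers
    all exponents are multiples of F^d for a highly divisible F, the divisions can
    be carried out, and the exponents stay below an explicit power of F.  So truth
    in a model amounts to an evaluation [bsat] with bounded quantifiers
    ([sat_bsat]).

    Everything follows from this.  For sentences, [bsat] does not mention the
    model, so all models agree, and Goedel's completeness theorem ([completeness])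
    turns truth in the reals into provability.  For formulas, finitely many
    quantifier-free formulas describe the relations that matter, so the formula is
    a Boolean combination of them in all models ([shannon_expansion]), and again the
    equivalence is provable.  Finally [bsat] is computable: a recursive function
    searches for a finite set of claims on the values of formulas and terms, each
    claim following from claims in the set about immediate parts, that settles the
    sentence ([certificate_formula], [certificate_exists]). *)

(** * Substitution *)

Definition up (sigma : nat -> term) : nat -> term :=
  scons (Var 0) (fun i => tsubst shift (sigma i)).

Lemma tsubst_comp sigma tau t :
  tsubst tau (tsubst sigma t) = tsubst (fun i => tsubst tau (sigma i)) t.
Proof. by elim: t => //= [s -> t ->|t ->]. Qed.

Lemma tsubst_id t : tsubst Var t = t.
Proof. by elim: t => //= [s -> t ->|t ->]. Qed.

Lemma up_comp sigma tau :
  (fun i => tsubst (up tau) (up sigma i)) = up (fun i => tsubst tau (sigma i)).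
Proof. by apply/funext => -[|i] //=; rewrite !tsubst_comp. Qed.

Lemma subst_comp A sigma tau :
  subst tau (subst sigma A) = subst (fun i => tsubst tau (sigma i)) A.
Proof.
elim: A sigma tau => //= [s t|t|A IHA B IHB|A IHA] sigma tau.
- by rewrite !tsubst_comp.
- by rewrite tsubst_comp.
- by rewrite IHA IHB.
- by rewrite IHA up_comp.
Qed.

Lemma up_id : up Var = Var.
Proof. by apply/funext => -[|i]. Qed.

Lemma subst_id A : subst Var A = A.
Proof.
elim: A => //= [s t|t|A -> B ->|A IHA] //; rewrite ?tsubst_id //.
by rewrite -[scons _ _]/(up Var) up_id IHA.
Qed.

Lemma subst_inst A t sigma :
  subst sigma (inst A t) = inst (subst (up sigma) A) (tsubst sigma t).
Proof.
rewrite /inst !subst_comp; congr subst; apply/funext => -[|i] //=.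
by rewrite tsubst_comp /= tsubst_id.
Qed.

Lemma subst_shift A sigma :
  subst (up sigma) (subst shift A) = subst shift (subst sigma A).
Proof. by rewrite !subst_comp. Qed.

Lemma subst_scons A t sigma :
  inst (subst (up sigma) A) t = subst (scons t sigma) A.
Proof.
rewrite /inst subst_comp; congr subst; apply/funext => -[|i] //=.
by rewrite tsubst_comp /= tsubst_id.
Qed.

Lemma tbounded_subst n t sigma tau : tbounded n t ->
  (forall i, i < n -> sigma i = tau i) -> tsubst sigma t = tsubst tau t.
Proof.
move=> + st; elim: t => //= [s IHs t IHt /andP[/IHs-> /IHt->]|t IHt /IHt->] //.
Qed.

Lemma bounded_subst n A sigma tau : bounded n A ->
  (forall i, i < n -> sigma i = tau i) -> subst sigma A = subst tau A.
Proof.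
elim: A n sigma tau => //= [s t|t|A IHA B IHB|A IHA] n sigma tau.
- by move=> /andP[bs bt] st; rewrite (tbounded_subst bs st) (tbounded_subst bt st).
- by move=> bt st; rewrite (tbounded_subst bt st).
- by move=> /andP[bA bB] st; rewrite (IHA _ _ _ bA st) (IHB _ _ _ bB st).
- move=> bA st; congr All; apply: (IHA _ _ _ bA) => -[|i] //= lt_in.
  by rewrite st.
Qed.

Lemma tbounded_mono m n t : m <= n -> tbounded m t -> tbounded n t.
Proof.
move=> le_mn; elim: t => //= [i|s IHs t IHt /andP[/IHs-> /IHt->]] //.
by move=> /leq_trans; apply.
Qed.

Lemma bounded_mono m n A : m <= n -> bounded m A -> bounded n A.
Proof.
elim: A m n => //= [s t|t|A IHA B IHB|A IHA] m n le_mn.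
- by move=> /andP[/(tbounded_mono le_mn)-> /(tbounded_mono le_mn)->].
- exact: tbounded_mono.
- by move=> /andP[/(IHA _ _ le_mn)-> /(IHB _ _ le_mn)->].
- exact: IHA.
Qed.

Lemma tbounded_exists t : exists n, tbounded n t.
Proof.
elim: t => [i||||s [m bs] t [n bt]|t [n bt]]; try by exists 0.
- by exists i.+1 => /=.
- exists (maxn m n) => /=.
  by rewrite (tbounded_mono (leq_maxl m n) bs) (tbounded_mono (leq_maxr m n) bt).
- by exists n.
Qed.

Lemma bounded_exists A : exists n, bounded n A.
Proof.
elim: A => [|s t|t|A [m bA] B [n bB]|A [n bA]]; first by exists 0.
- have [m bs] := tbounded_exists s; have [n bt] := tbounded_exists t.
  exists (maxn m n) => /=.
  by rewrite (tbounded_mono (leq_maxl m n) bs) (tbounded_mono (leq_maxr m n) bt).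
- exact: tbounded_exists.
- exists (maxn m n) => /=.
  by rewrite (bounded_mono (leq_maxl m n) bA) (bounded_mono (leq_maxr m n) bB).
- by exists n; apply: bounded_mono bA.
Qed.

Lemma tbounded_tsubst m n t sigma : tbounded m t ->
  (forall i, i < m -> tbounded n (sigma i)) -> tbounded n (tsubst sigma t).
Proof.
move=> + bs; elim: t => //= [s IHs t IHt /andP[/IHs-> /IHt->]] //.
Qed.

Lemma bounded_subst_bounded m n A sigma : bounded m A ->
  (forall i, i < m -> tbounded n (sigma i)) -> bounded n (subst sigma A).
Proof.
elim: A m n sigma => //= [s t|t|A IHA B IHB|A IHA] m n sigma.
- by move=> /andP[b1 b2] bs; rewrite !(tbounded_tsubst _ bs).
- by move=> b1 bs; rewrite (tbounded_tsubst _ bs).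
- by move=> /andP[b1 b2] bs; rewrite (IHA _ _ _ b1 bs) (IHB _ _ _ b2 bs).
- move=> bA bs; apply: IHA bA _ => -[|i] //= lt_im.
  by apply: tbounded_tsubst (bs _ lt_im) _.
Qed.

(** * Semantics *)

Section Semantics.
Variable M : structure.
Implicit Types (e : nat -> M) (A B : formula).

Lemma teval_tsubst e sigma t :
  teval e (tsubst sigma t) = teval (fun i => teval e (sigma i)) t.
Proof. by elim: t => //= [s -> t ->|t ->]. Qed.

Lemma sat_subst A e sigma :
  sat e (subst sigma A) <-> sat (fun i => teval e (sigma i)) A.
Proof.
elim: A e sigma => //= [s t|t|A IHA B IHB|A IHA] e sigma.
- by rewrite !teval_tsubst.
- by rewrite teval_tsubst.
- by rewrite IHA IHB.
- have E x : (fun i => teval (scons x e) (up sigma i)) =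
             scons x (fun i => teval e (sigma i)).
    by apply/funext => -[|i] //=; rewrite teval_tsubst.
  by split=> H x; move: (H x); rewrite -[scons (Var _) _]/(up sigma) IHA E.
Qed.

Lemma teval_bounded n t e1 e2 : tbounded n t ->
  (forall i, i < n -> e1 i = e2 i) -> teval e1 t = teval e2 t.
Proof.
move=> + ee; elim: t => //= [s IHs t IHt /andP[/IHs-> /IHt->]|t IHt /IHt->] //.
Qed.

Lemma sat_bounded n A e1 e2 : bounded n A ->
  (forall i, i < n -> e1 i = e2 i) -> sat e1 A <-> sat e2 A.
Proof.
elim: A n e1 e2 => //= [s t|t|A IHA B IHB|A IHA] n e1 e2.
- by move=> /andP[bs bt] ee; rewrite (teval_bounded bs ee) (teval_bounded bt ee).
- by move=> bt ee; rewrite (teval_bounded bt ee).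
- by move=> /andP[bA bB] ee; rewrite (IHA _ _ _ bA ee) (IHB _ _ _ bB ee).
- move=> bA ee.
  suff H x : sat (scons x e1) A <-> sat (scons x e2) A by split=> h x; apply/H.
  by apply: (IHA _ _ _ bA) => -[|i] //= lt_in; rewrite ee.
Qed.

Lemma sat_neg e A : sat e (Neg A) <-> ~ sat e A.
Proof. by []. Qed.

Lemma sat_and e A B : sat e (And A B) <-> sat e A /\ sat e B.
Proof.
split=> [/= h|/= [hA hB]]; last exact.
by split; apply: contrapT => h'; apply: h => //.
Qed.

Lemma sat_or e A B : sat e (Or A B) <-> sat e A \/ sat e B.
Proof.
split=> [/= h|/= [hA hN|hB _]] //.
by have [?|?] := EM (sat e A); [left|right; apply: h].
Qed.

Lemma sat_iff e A B : sat e (Iff A B) <-> (sat e A <-> sat e B).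
Proof. by rewrite sat_and /=. Qed.

Lemma sat_all e A : sat e (All A) <-> forall x, sat (scons x e) A.
Proof. by []. Qed.

Lemma sat_imp e A B : sat e (Imp A B) <-> (sat e A -> sat e B).
Proof. by []. Qed.

Lemma sat_ex e A : sat e (Ex A) <-> exists x, sat (scons x e) A.
Proof.
split=> [/= h|/= [x hx] /(_ x)]; last exact.
by apply: contrapT => h'; apply: h => x hx; apply: h'; exists x.
Qed.

End Semantics.

Lemma soundness T A : prv T A -> forall (M : structure) (e : nat -> M),
  (forall B, T B -> sat e B) -> sat e A.
Proof.
elim=> {T A} [T A TA|T A B _ IH|T A B _ IHAB _ IHA|T A _ IH|T A _ IH
             |T A t _ IH|T t|T A s t _ IHe _ IHA] M e hT //=.
- exact: hT.
- by move=> hA; apply: IH => C [/hT|->].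
- by apply: IHAB => //; apply: IHA.
- by apply: contrapT => hA; apply: (IH M e) => C [/hT|->].
- move=> x; apply: IH => _ [B /hT hB ->]; exact/sat_subst.
- have /= hA := IH M e hT; apply/sat_subst.
  have -> : (fun i => teval e (scons t Var i)) = scons (teval e t) e.
    by apply/funext => -[|i].
  exact: hA.
- have /= est := IHe M e hT.
  have /sat_subst := IHA M e hT; rewrite sat_subst.
  set f1 := (fun i => _); set f2 := (fun i => _); suff -> : f1 = f2 by [].
  by apply/funext => -[|i].
Qed.

(** * Structural properties of provability *)

Notation "T ',,' A" := (fun C => T C \/ C = A)
  (at level 84, left associativity).

Lemma prv_weak (T T' : theory) A :
  prv T A -> (forall B, T B -> T' B) -> prv T' A.
Proof.
move=> pA; elim: pA T' => {T A} [T A TA|T A B _ IH|T A B _ IHAB _ IHA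
  |T A _ IH|T A _ IH|T A t _ IH|T t|T A s t _ IHe _ IHA] T' sT.
- exact/prv_hyp/sT.
- by apply/prv_impI/IH => C [/sT|]; [left|right].
- by apply: prv_impE; [apply: IHAB|apply: IHA].
- by apply/prv_raa/IH => C [/sT|]; [left|right].
- by apply/prv_allI/IH => C [B /sT TB ->]; exists B.
- exact/prv_allE/IH.
- exact: prv_refl.
- by apply: prv_leibniz; [apply: IHe|apply: IHA].
Qed.

(** Substituting in a whole proof is what allows a fresh variable to act as a
    constant. *)
Lemma prv_subst (T : theory) A sigma : prv T A ->
  prv (fun C => exists2 B, T B & C = subst sigma B) (subst sigma A).
Proof.
move=> pA; elim: pA sigma => {T A} [T A TA|T A B _ IH|T A B _ IHAB _ IHA
  |T A _ IH|T A _ IH|T A t _ IH|T t|T A s t _ IHe _ IHA] sigma /=.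
- by apply: prv_hyp; exists A.
- apply: prv_impI; apply: prv_weak (IH sigma) _ => C [D [TD|->] ->]; last by right.
  by left; exists D.
- by apply: prv_impE; [apply: IHAB|apply: IHA].
- apply: prv_raa; apply: prv_weak (IH sigma) _ => C [D [TD|->] ->]; last by right.
  by left; exists D.
- apply: prv_allI; apply: prv_weak (IH (up sigma)) _ => C [D [E TE ->] ->].
  by exists (subst sigma E); [exists E|rewrite subst_shift].
- by rewrite subst_inst; apply/prv_allE/IH.
- exact: prv_refl.
- rewrite subst_inst; apply: prv_leibniz (IHe sigma) _.
  by rewrite -subst_inst; apply: IHA.
Qed.

(** The proof may use a different stage of the chain at every leaf; being
    increasing, the chain has a single stage that serves all of them. *)
Lemma prv_chain (G : nat -> theory) (T : theory) A : prv T A ->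
  (forall m n B, m <= n -> G m B -> G n B) ->
  (forall B, T B -> exists k, G k B) -> exists k, prv (G k) A.
Proof.
move=> pA; elim: pA G => {T A} [T A TA|T A B _ IH|T A B _ IHAB _ IHA
  |T A _ IH|T A _ IH|T A t _ IH|T t|T A s t _ IHe _ IHA] G mG TG.
- by have [k Gk] := TG _ TA; exists k; apply: prv_hyp.
- have [] := IH (fun k => G k,, A); last by move=> k; exists k; apply: prv_impI.
  + by move=> m n C le_mn [/(mG _ _ _ le_mn)|]; [left|right].
  + by move=> C [/TG [k Gk]|->]; [exists k; left|exists 0; right].
- have [k pk] := IHAB _ mG TG; have [l pl] := IHA _ mG TG.
  exists (maxn k l); apply: prv_impE; [apply: prv_weak pk _|apply: prv_weak pl _] => C.
    exact/mG/leq_maxl.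
  exact/mG/leq_maxr.
- have [] := IH (fun k => G k,, Neg A); last by move=> k; exists k; apply: prv_raa.
  + by move=> m n C le_mn [/(mG _ _ _ le_mn)|]; [left|right].
  + by move=> C [/TG [k Gk]|->]; [exists k; left|exists 0; right].
- have [] := IH (fun k C => exists2 B, G k B & C = subst shift B); last first.
  + by move=> k pk; exists k; apply: prv_allI.
  + by move=> C [B /TG [k Gk] ->]; exists k, B.
  + by move=> m n C le_mn [B /(mG _ _ _ le_mn) GB ->]; exists B.
- by have [k pk] := IH _ mG TG; exists k; apply: prv_allE.
- by exists 0; apply: prv_refl.
- have [k pk] := IHe _ mG TG; have [l pl] := IHA _ mG TG.
  exists (maxn k l); apply: prv_leibniz; [apply: prv_weak pk _|apply: prv_weak pl _] => C.
    exact/mG/leq_maxl.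
  exact/mG/leq_maxr.
Qed.

Lemma prv_cut (T : theory) A B : prv (T,, A) B -> prv T A -> prv T B.
Proof. by move=> /prv_impI; apply: prv_impE. Qed.

Lemma prv_last (T : theory) A : prv (T,, A) A.
Proof. by apply: prv_hyp; right. Qed.

Lemma prv_weak1 (T : theory) A B : prv T B -> prv (T,, A) B.
Proof. by move=> /prv_weak; apply => C; left. Qed.

Lemma prv_absurd (T : theory) A : prv T Bot -> prv T A.
Proof. by move=> /prv_weak1 h; apply: prv_raa. Qed.

(** The renaming that sends [Var n] to [Var 0] and shifts the others turns a
    proof about the constant-like variable [Var n] into one about the
    eigenvariable of [prv_allI]. *)
Lemma prv_gen (T : theory) A n : (forall B, T B -> bounded n B) ->
  bounded n.+1 A -> prv T (inst A (Var n)) -> prv T (All A).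
Proof.
move=> bT bA; pose rho i := if i == n then Var 0 else Var i.+1.
move=> /(prv_subst rho) pA; apply: prv_allI.
have <- : subst rho (inst A (Var n)) = A.
  rewrite /inst subst_comp -[RHS]subst_id; apply: (bounded_subst bA) => -[|i] /=.
    by rewrite /rho eqxx.
  by rewrite ltnS /rho => /ltn_eqF ->.
apply: prv_weak pA _ => C [B TB ->]; exists B => //.
by apply: (bounded_subst (bT _ TB)) => i; rewrite /rho => /ltn_eqF ->.
Qed.

(** * Completeness of the deduction system *)

Definition consistent (T : theory) : Prop := ~ prv T Bot.

Lemma cpair_monoL m n m' n' : m + n < m' + n' -> cpair m n < cpair m' n'.
Proof.
have tri s : (s.+1 * s.+2)./2 = (s * s.+1)./2 + s.+1.
  by rewrite -addn2 mulnDr [s.+1 * 2]mulnC mul2n -{1}[s.+1 * s]mulnC halfD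
     odd_double andbF add0n doubleK.
have mtri s t : s <= t -> (s * s.+1)./2 <= (t * t.+1)./2.
  by move=> le_st; apply/half_leq/leq_mul.
move=> lt_s; rewrite /cpair.
apply: leq_trans (leq_addr _ _); apply: leq_trans (mtri _ _ lt_s).
by rewrite tri -addnS leq_add2l ltnS leq_addl.
Qed.

Lemma cpair_inj m n m' n' : cpair m n = cpair m' n' -> m = m' /\ n = n'.
Proof.
move=> eqc.
have eqs : m + n = m' + n'.
  by case: (ltngtP (m + n) (m' + n')) => // /cpair_monoL; rewrite eqc ltnn.
move: eqc; rewrite /cpair -eqs => /addnI eqn.
by move: eqs; rewrite eqn => /addIn.
Qed.

Lemma tcode_inj : injective tcode.
Proof.
elim=> [i||||s IHs t IHt|t IHt] [j||||s' t'|t'] //= /cpair_inj[] // _.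
- by move=> ->.
- by move=> /cpair_inj[/IHs-> /IHt->].
- by move=> /IHt->.
Qed.

Lemma code_inj : injective code.
Proof.
elim=> [|s t|t|A IHA B IHB|A IHA] [|s' t'|t'|A' B'|A'] //= /cpair_inj[] // _.
- by move=> /cpair_inj[/tcode_inj-> /tcode_inj->].
- by move=> /tcode_inj->.
- by move=> /cpair_inj[/IHA-> /IHB->].
- by move=> /IHA->.
Qed.

(** One step of Lindenbaum's construction, with Henkin witnesses: whenever a
    universal formula is refuted, a fresh variable is made a counterexample.
    The bound [n] on the variables in use provides the fresh one. *)
Lemma henkin_step (T : theory) n k : consistent T ->
  (forall B, T B -> bounded n B) ->
  exists T' : theory, [/\ forall B, T B -> T' B, consistent T',
    exists n', forall B, T' B -> bounded n' B &
    forall A, code A = k -> T' A \/ (T' (Neg A) /\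
      forall A', A = All A' -> exists c, T' (Neg (inst A' (Var c))))].
Proof.
move=> cT bT; have [[A eA]|noA] := EM (exists A, code A = k); last first.
  exists T; split=> //; first by exists n.
  by move=> A eA; case: noA; exists A.
have [m bA] := bounded_exists A; pose N := maxn n m.
have bTN B : T B -> bounded N B.
  by move=> /bT; apply: bounded_mono (leq_maxl _ _).
have bAN : bounded N A by apply: bounded_mono bA; apply: leq_maxr.
have [cA|incA] := EM (consistent (T,, A)).
  exists (T,, A); split=> //; first by left.
    by exists N => B [/bTN|->].
  by move=> B; rewrite -eA => /code_inj ->; left; right.
have pNA : prv T (Neg A) by apply: prv_impI; apply: contrapT.
have cN : consistent (T,, Neg A) by move=> pB; apply: cT; apply: prv_cut pB pNA.
have [[A' eA']|nall] := EM (exists A', A = All A'); last first.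
  exists (T,, Neg A); split=> //; first by left.
    by exists N => B [/bTN|->] //=; rewrite bAN.
  move=> B; rewrite -eA => /code_inj ->; right; split; first by right.
  by move=> A' eA'; case: nall; exists A'.
subst A; exists (T,, Neg (All A'),, Neg (inst A' (Var N))); split.
- by move=> B TB; left; left.
- move=> /prv_raa /prv_gen gA; apply: cN; apply: prv_impE (prv_last _ _) _.
  by apply: gA => // B [/bTN|->] //=; rewrite andbT.
- exists N.+1 => B [[/bTN|->]|->] /=.
  + exact: bounded_mono.
  + by rewrite andbT; apply: bounded_mono bAN.
  + rewrite andbT; apply: (bounded_subst_bounded (m := N.+1) bAN) => -[|i] //= lti.
    exact: ltnW.
- move=> B; rewrite -eA => /code_inj ->; right; split; first by left; right.
  by move=> A'' [<-]; exists N; right.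
Qed.

(** A maximal consistent theory with witnesses: the truths of its term model. *)
Definition henkin (D : theory) : Prop := [/\ consistent D,
  forall A, D A \/ D (Neg A) &
  forall A, D (Neg (All A)) -> exists t, D (Neg (inst A t))].

Lemma henkin_extension (T : theory) n : consistent T ->
  (forall B, T B -> bounded n B) ->
  exists2 D, henkin D & forall B, T B -> D B.
Proof.
move=> cT bT.
pose good (G : theory) := consistent G /\ exists n, forall B, G B -> bounded n B.
pose next k (G G' : theory) := [/\ forall B, G B -> G' B, good G' &
    forall A, code A = k -> G' A \/ (G' (Neg A) /\
      forall A', A = All A' -> exists c, G' (Neg (inst A' (Var c))))].
have step k (G : {G | good G}) : exists G' : {G | good G}, next k (sval G) (sval G').
  case: G => G [cG [m bG]] /=.
  have [G' [GG' cG' bG' hG']] := henkin_step k cG bG.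
  have gG' : good G' by [].
  by exists (exist _ G' gG').
have gT : good T by split => //; exists n.
pose chain := nat_rect (fun=> {G | good G}) (exist _ T gT)
  (fun k G => projT1 (cid (step k G))).
pose G k := sval (chain k).
have nextG k : next k (G k) (G k.+1) by exact: (projT2 (cid (step k (chain k)))).
have mG k l B : k <= l -> G k B -> G l B.
  move=> /subnK <-; elim: (l - k) => // j IHj /IHj; rewrite addSn.
  by case: (nextG (j + k)) => + _ _; apply.
have cG k : consistent (G k) by case: (svalP (chain k)).
pose D B := exists k, G k B.
have cD : consistent D.
  by move=> pD; have [k] := prv_chain pD mG (fun B => id); apply: cG.
have comp A : D A \/ (D (Neg A) /\
      forall A', A = All A' -> exists c, D (Neg (inst A' (Var c)))).
  have [_ _ /(_ A erefl)] := nextG (code A).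
  move=> [GA|[GA hA]]; [left|right]; first by exists (code A).+1.
  split; first by exists (code A).+1.
  by move=> A' /hA [c Gc]; exists c, (code A).+1.
exists D; last by move=> B TB; exists 0.
split=> // A.
  by have [|[]] := comp A; [left|right].
move=> DA; have [DA'|[_ /(_ _ erefl) [c Dc]]] := comp (All A).
  by case: cD; apply: prv_impE (prv_hyp DA) (prv_hyp DA').
by exists (Var c).
Qed.

Section TermModel.
Variables (D : theory) (hD : henkin D).

Let cD : consistent D. Proof. by case: hD. Qed.

Lemma henkin_prv A : prv D A -> D A.
Proof.
move=> pA; case: hD => _ /(_ A) [//|DA] _.
by case: cD; apply: prv_impE pA; apply: prv_hyp.
Qed.

Lemma henkin_imp A B : D (Imp A B) <-> (D A -> D B).
Proof.
split=> [DAB DA|h].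
  by apply/henkin_prv/prv_impE; apply: prv_hyp; [apply: DAB|].
apply/henkin_prv/prv_impI; case: hD => _ /(_ A) [/h DB|DNA] _.
  exact/prv_weak1/prv_hyp.
apply: prv_absurd; apply: prv_impE (prv_last _ _).
exact/prv_weak1/prv_hyp.
Qed.

Lemma henkin_bot : ~ D Bot.
Proof. by move=> /prv_hyp; apply: cD. Qed.

Lemma henkin_all A : D (All A) <-> forall t, D (inst A t).
Proof.
split=> [DA t|h]; first exact/henkin_prv/prv_allE/prv_hyp.
case: hD => _ /(_ (All A)) [//|DNA] /(_ _ DNA) [t Dt].
by case: henkin_bot; move: Dt (h t) => /henkin_imp.
Qed.

Let eqD s t := D (Eq s t).

Lemma eqD_leibniz A s t : eqD s t -> D (inst A s) -> D (inst A t).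
Proof.
by move=> est DA; apply/henkin_prv/(prv_leibniz (s := s)); apply: prv_hyp.
Qed.

Let instK t u : tsubst (scons t Var) (tsubst shift u) = u.
Proof. by rewrite tsubst_comp tsubst_id. Qed.

Lemma eqD_refl t : eqD t t.
Proof. exact/henkin_prv/prv_refl. Qed.

Lemma eqD_sym s t : eqD s t -> eqD t s.
Proof.
move=> est; have := eqD_leibniz (A := Eq (Var 0) (tsubst shift s)) est.
by rewrite /inst /= !instK; apply; apply: eqD_refl.
Qed.

Lemma eqD_trans s t u : eqD s t -> eqD t u -> eqD s u.
Proof.
move=> est etu; have := eqD_leibniz (A := Eq (tsubst shift s) (Var 0)) etu.
by rewrite /inst /= !instK; apply.
Qed.

Lemma eqD_mul s s' t t' : eqD s s' -> eqD t t' -> eqD (Mul s t) (Mul s' t').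
Proof.
move=> es et; apply: (@eqD_trans _ (Mul s' t)).
  have := eqD_leibniz
    (A := Eq (Mul (tsubst shift s) (tsubst shift t)) (Mul (Var 0) (tsubst shift t))) es.
  by rewrite /inst /= !instK; apply; apply: eqD_refl.
have := eqD_leibniz
  (A := Eq (Mul (tsubst shift s') (tsubst shift t)) (Mul (tsubst shift s') (Var 0))) et.
by rewrite /inst /= !instK; apply; apply: eqD_refl.
Qed.

Lemma eqD_inv s s' : eqD s s' -> eqD (Inv s) (Inv s').
Proof.
move=> es.
have := eqD_leibniz (A := Eq (Inv (tsubst shift s)) (Inv (Var 0))) es.
by rewrite /inst /= !instK; apply; apply: eqD_refl.
Qed.

Lemma eqD_pos s s' : eqD s s' -> D (Pos s) -> D (Pos s').
Proof. by move=> es; apply: (eqD_leibniz (A := Pos (Var 0)) es). Qed.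

(** An element of the term model is a class of provably equal terms, so that the
    equality of the model is Leibniz equality. *)
Let tclass := {P : term -> Prop | exists t, P = eqD t}.
Let cls t : tclass := exist _ (eqD t) (ex_intro _ t erefl).
Let rep (x : tclass) : term := projT1 (cid (svalP x)).

Let clsP s t : cls s = cls t <-> eqD s t.
Proof.
split=> [[]|est]; first by move=> /(congr1 (@^~ t)) ->; apply: eqD_refl.
apply: eq_exist; apply/funext => u; apply/propext.
by split; apply: eqD_trans => //; apply: eqD_sym.
Qed.

Let repK x : cls (rep x) = x.
Proof. by case: x => P h; apply: eq_exist; rewrite /rep; case: cid => t /= ->. Qed.

Let repP t : eqD (rep (cls t)) t.
Proof. by apply/clsP; rewrite repK. Qed.

Let term_model : structure := @Structure tclass (cls Zero) (cls One) (cls MOne)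
  (fun x y => cls (Mul (rep x) (rep y))) (fun x => cls (Inv (rep x)))
  (fun x => D (Pos (rep x))).

Let teval_model sigma t :
  teval (M := term_model) (fun i => cls (sigma i)) t = cls (tsubst sigma t).
Proof.
elim: t => //= [s -> t ->|t ->]; apply/clsP.
  by apply: eqD_mul; apply: repP.
by apply: eqD_inv; apply: repP.
Qed.

Let sat_model A sigma :
  sat (M := term_model) (fun i => cls (sigma i)) A <-> D (subst sigma A).
Proof.
elim: A sigma => /= [|s t|t|A IHA B IHB|A IHA] sigma.
- by split=> // /henkin_bot.
- by rewrite !teval_model clsP.
- by rewrite teval_model; split; apply: eqD_pos => //; apply: eqD_sym.
- by rewrite IHA IHB henkin_imp.
- have E t : (fun i => cls (scons t sigma i)) =
             scons (cls t) (fun i => cls (sigma i)).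
    by apply/funext => -[|i].
  rewrite henkin_all -[scons (Var _) _]/(up sigma); split=> h.
    by move=> t; rewrite subst_scons -IHA E; apply: h.
  by move=> x; rewrite -(repK x) -E IHA -subst_scons; apply: h.
Qed.

Lemma henkin_model : exists (M : structure) (e : nat -> M),
  forall A, sat e A <-> D A.
Proof.
exists term_model, (fun i => cls (Var i)) => A.
by rewrite sat_model subst_id.
Qed.

End TermModel.

(** Goedel's completeness theorem; the bound leaves variables free for use as
    Henkin constants. *)
Lemma completeness (T : theory) n A : (forall B, T B -> bounded n B) ->
  (forall (M : structure) (e : nat -> M), (forall B, T B -> sat e B) -> sat e A) ->
  prv T A.
Proof.
move=> bT hA; apply: prv_raa; apply: contrapT => cT.
have [m bA] := bounded_exists A.
have [|D hD TD] := henkin_extension (n := maxn n m) cT.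
  move=> B [/bT|->] /=.
    by apply: bounded_mono; apply: leq_maxl.
  by rewrite andbT; apply: bounded_mono bA; apply: leq_maxr.
have [M [e satM]] := henkin_model hD.
have /satM : D (Neg A) by apply: TD; right.
by apply; apply: hA => B TB; apply/satM/TD; left.
Qed.

(** * Signed groups: the shape of all models *)

Section SignedGroup.
Variable V : zmodType.
Local Open Scope ring_scope.

Definition smul (x y : option (bool * V)) : option (bool * V) :=
  match x, y with
  | Some (b, u), Some (c, v) => Some (b == c, u + v)
  | _, _ => None
  end.

(** The group V is written additively; [Some (true, v)] stands for the positive
    element v, [Some (false, v)] for its opposite and [None] for zero. *)
Definition signed : structure :=
  @Structure (option (bool * V)) None (Some (true, 0)) (Some (false, 0)) smul
    (fun x => if x is Some (b, v) then Some (b, - v) else None)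
    (fun x => if x is Some (true, _) then True else False).

Definition sign (x : signed) : option bool := omap fst x.
Definition expo (x : signed) : V := if x is Some (_, v) then v else 0.

Lemma signed_eq (x y : signed) :
  x = y <-> sign x = sign y /\ (sign x <> None -> expo x = expo y).
Proof.
split=> [->//|].
by case: x y => [[b u]|] [[c v]|] // [] // [->] /= ->.
Qed.

Definition divisible_torsion_free : Prop :=
  [/\ exists u : V, u <> 0,
      forall (v : V) k, (0 < k)%N -> v *+ k = 0 -> v = 0 &
      forall (v : V) k, (0 < k)%N -> exists u, u *+ k = v].

End SignedGroup.

Definition model_of (M : structure) (T : theory) : Prop :=
  forall A, T A -> forall e : nat -> M, sat e A.

Lemma teval_morph (M N : structure) (phi : M -> N) e t :
  phi (zeroI M) = zeroI N -> phi (oneI M) = oneI N -> phi (moneI M) = moneI N ->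
  {morph phi : x y / mulI x y >-> mulI x y} -> {morph phi : x / invI x >-> invI x} ->
  teval (fun i => phi (e i)) t = phi (teval e t).
Proof.
move=> h0 h1 hm hM hV; elim: t => //= [s -> t ->|t ->].
  by rewrite hM.
by rewrite hV.
Qed.

Lemma sat_iso (M N : structure) (phi : M -> N) e A :
  phi (zeroI M) = zeroI N -> phi (oneI M) = oneI N -> phi (moneI M) = moneI N ->
  {morph phi : x y / mulI x y >-> mulI x y} -> {morph phi : x / invI x >-> invI x} ->
  (forall x, posI (phi x) <-> posI x) ->
  injective phi -> (forall y, exists x, phi x = y) ->
  sat (fun i => phi (e i)) A <-> sat e A.
Proof.
move=> h0 h1 hm hM hV hP iphi sphi.
have te e' t := teval_morph e' t h0 h1 hm hM hV.
elim: A e => /= [|s t|t|A IHA B IHB|A IHA] e.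
- by [].
- by rewrite !te; split=> [/iphi|->].
- by rewrite te.
- by rewrite IHA IHB.
- have E x : (fun i => phi (scons x e i)) = scons (phi x) (fun i => phi (e i)).
    by apply/funext => -[|i].
  split=> h x; first by rewrite -IHA E.
  by have [y <-] := sphi x; rewrite -E IHA.
Qed.

Section ModelStructure.
Variables (M : structure) (hM : model_of M axM).

Let z : nat -> M := fun=> zeroI M.
Local Notation "x ** y" := (mulI (s := M) x y) (at level 40, left associativity).
Local Notation "''0'" := (zeroI M).
Local Notation "''1'" := (oneI M).
Local Notation "''m'" := (moneI M).
Local Notation pos := (posI (s := M)).
Local Notation inv := (invI (s := M)).

Let mA x y w : x ** (y ** w) = (x ** y) ** w.
Proof. exact: (hM M1 z x y w). Qed.
Let m1 x : x ** '1 = x.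
Proof. exact: (hM M2 z x). Qed.
Let mC x y : x ** y = y ** x.
Proof. exact: (hM M4 z x y). Qed.
Let mV x : x <> '0 -> x ** inv x = '1.
Proof. exact: (hM M3 z x). Qed.
Let m0 x : x ** '0 = '0.
Proof. by have /sat_and[] := (sat_all _ _).1 (hM M10 z) x. Qed.
Let inv0 : inv '0 = '0.
Proof. by have /sat_and[_ /= <-] := (sat_all _ _).1 (hM M10 z) '0. Qed.
Let one_neq0 : '1 <> '0.
Proof.
move=> e10; have /sat_ex[y /sat_and[_ /sat_and[/= y0 _]]] := hM M9 z.
by apply: y0; rewrite -(m1 y) e10 m0.
Qed.
Let mul_eq0 x y : x ** y = '0 -> x <> '0 -> y = '0.
Proof.
by move=> xy0 /mV xV; rewrite -(m1 y) -xV mA [y ** x]mC xy0 mC m0.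
Qed.
Let mul_neq0 x y : x <> '0 -> y <> '0 -> x ** y <> '0.
Proof. by move=> x0 y0 /mul_eq0 /(_ x0). Qed.
Let mulI_ x y w : x <> '0 -> x ** y = x ** w -> y = w.
Proof.
move=> /mV xV /(congr1 (mulI (inv x))).
by rewrite !mA ![inv x ** x]mC xV ![_ ** y]mC ![_ ** w]mC !m1.
Qed.
Let inv_neq0 x : x <> '0 -> inv x <> '0.
Proof. by move=> x0 e; apply: one_neq0; rewrite -(mV x0) e m0. Qed.

Let pw x k := iter k (mulI x) '1.

Let teval_Pow e t k : teval (M := M) e (Pow t k) = pw (teval e t) k.
Proof.
rewrite /Pow /pw; case: k => // k; rewrite iteropS.
elim: k => [|k IHk]; first by rewrite /= m1.
by rewrite iterS [RHS]iterS -IHk.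
Qed.

Let pwD x k l : pw x (k + l) = pw x k ** pw x l.
Proof.
elim: k => [|k IHk]; first by rewrite mC m1.
by rewrite addSn /pw !iterS -/(pw _ _) IHk -mA.
Qed.
Let pwMl x y k : pw (x ** y) k = pw x k ** pw y k.
Proof.
elim: k => [|k IHk]; first by rewrite m1.
rewrite /pw !iterS -!/(pw _ _) IHk -!mA; congr (_ ** _).
by rewrite [RHS]mA [_ ** y]mC mA.
Qed.
Let pwM x k l : pw x (k * l) = pw (pw x k) l.
Proof.
elim: l => [|l IHl]; first by rewrite muln0.
by rewrite mulnS pwD IHl.
Qed.
Let pw1 x : pw x 1 = x. Proof. exact: m1. Qed.

Let m11 n x : 0 < n -> pw x (2 * n) = '1 <-> x = '1 \/ x = 'm.
Proof.
move=> n0; have := (sat_all _ _).1 (hM (M11 n0) z) x; rewrite sat_iff sat_or.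
by rewrite -[x in pw x]/(teval (M := M) (scons x z) (Var 0)) -teval_Pow.
Qed.
Let m12 n x : exists y, x = pw y (2 * n + 1).
Proof.
case: n => [|n]; first by exists x; rewrite pw1.
have [y xy] := (sat_ex _ _).1 ((sat_all _ _).1 (hM (@M12 n.+1 isT) z) x).
by exists y; rewrite -[y in pw y]/(teval (M := M) (scons y (scons x z)) (Var 0)) -teval_Pow.
Qed.
Let m13 x : pos x <-> exists2 y, y <> '0 & x = y ** y.
Proof.
have := (sat_all _ _).1 (hM M13 z) x; rewrite sat_iff sat_ex => -[h1 h2].
by split=> [/h1[y /sat_and[/= ? ?]]|[y ? ?]]; [exists y|apply: h2; exists y; apply/sat_and].
Qed.
Let m14 x : x <> '0 -> ~ pos x <-> pos ('m ** x).
Proof. by move=> x0; have /sat_imp/(_ x0)/sat_iff := (sat_all _ _).1 (hM M14 z) x. Qed.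
Let m15 x y : x <> '0 -> y <> '0 -> pos (x ** y) <-> (pos x <-> pos y).
Proof.
move=> x0 y0; have /sat_imp h := (sat_all _ _).1 ((sat_all _ _).1 (hM M15 z) x) y.
have /h /sat_iff : sat (scons y (scons x z)) (Var 1 <>' Zero /\' Var 0 <>' Zero)%fo.
  by apply/sat_and.
by rewrite sat_iff.
Qed.

Let mm1 : 'm ** 'm = '1.
Proof.
have : pw 'm (2 * 1) = '1 by apply/m11 => //; right.
by rewrite /pw /= m1.
Qed.
Let m_neq0 : 'm <> '0.
Proof. by move=> e; apply: one_neq0; rewrite -mm1 e m0. Qed.
Let pos1 : pos '1.
Proof. by apply/m13; exists '1; rewrite ?m1. Qed.
Let pos_neq0 x : pos x -> x <> '0.
Proof. by move=> /m13[y y0 ->]; apply: mul_neq0. Qed.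
Let mK x : 'm ** ('m ** x) = x.
Proof. by rewrite mA mm1 mC m1. Qed.
Let posM x y : pos x -> pos y -> pos (x ** y).
Proof. by move=> px py; apply/m15 => //; apply: pos_neq0. Qed.
Let posN x : pos x -> ~ pos ('m ** x).
Proof. by move=> px /(m14 (pos_neq0 px)). Qed.
Let posV x : pos x -> pos (inv x).
Proof.
move=> px; have x0 := pos_neq0 px.
by have := m15 x0 (inv_neq0 x0); rewrite mV // => -[/(_ pos1) [/(_ px)]].
Qed.
Let pos_sqrt x : pos x -> exists2 y, pos y & x = y ** y.
Proof.
move=> /m13[y y0 ->]; have [py|/(m14 y0) py] := EM (pos y); first by exists y.
by exists ('m ** y) => //; rewrite [RHS]mA [_ ** 'm]mC mK.
Qed.
(** Roots of even order come from repeated halving.  For odd order the root is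
    taken of a square root r, so that its square is a root that is positive. *)
Let pos_root k x : 0 < k -> pos x -> exists2 y, pos y & x = pw y k.
Proof.
elim/ltn_ind: k x => k IHk x k0 px; have [r pr ->] := pos_sqrt px.
case ok: (odd k).
  have [s es] := m12 k./2 r.
  have s0 : s <> '0.
    move=> s0; apply: (pos_neq0 pr); rewrite es s0 pwD pw1; exact: m0.
  exists (s ** s); first by apply/m13; exists s.
  rewrite pwMl; suff -> : k = 2 * k./2 + 1 by rewrite -es.
  by rewrite addn1 mul2n -[LHS]odd_double_half ok.
have ek : k = k./2 * 2 by rewrite muln2 -[LHS]odd_double_half ok.
have [||s ps rs] := IHk k./2 _ r _ pr.
- by rewrite {2}ek muln2 -addnn -[X in X < _]addn0 ltn_add2l; case: k./2 ek k0 => // ->.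
- by case: k./2 ek k0 => // ->.
by exists s => //; rewrite ek pwM -rs /pw /= m1.
Qed.

(** Additive notation turns powers into integer multiples, the coefficients of the
    linear relations below. *)
Lemma positive_group : exists (V : zmodType) (f : V -> M),
  [/\ injective f, forall x, pos x <-> exists v, f v = x,
      {morph f : u v / (u + v)%R >-> mulI u v}, f 0%R = '1 &
      {morph f : u / (- u)%R >-> invI u}].
Proof.
pose T := {x : M | pos x}.
have valI (u v : T) : sval u = sval v -> u = v.
  by case: u v => x px [y py] /= e; apply: eq_exist.
pose add (u v : T) : T := exist _ _ (posM (svalP u) (svalP v)).
pose opp (u : T) : T := exist _ _ (posV (svalP u)).
have addA : associative add by move=> u v w; apply: valI; apply: mA.
have addC : commutative add by move=> u v; apply: valI; apply: mC.
have add0 : left_id (exist _ _ pos1 : T) add.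
  by move=> u; apply: valI; rewrite /= mC m1.
have addN : left_inverse (exist _ _ pos1 : T) opp add.
  by move=> u; apply: valI; rewrite /= mC mV //; apply: pos_neq0 (svalP u).
pose C : choiceType := HB.pack T (gen_eqMixin T) (gen_choiceMixin T).
pose V : zmodType := HB.pack (Choice.sort C) (GRing.isZmodule.Build C addA addC add0 addN).
exists V, (fun v : T => sval v); split=> // x.
by split=> [px|[v <-]]; [exists (exist _ x px)|apply: svalP].
Qed.

Section Isomorphism.
Variables (V : zmodType) (f : V -> M).
Hypotheses (f_inj : injective f) (f_pos : forall x, pos x <-> exists v, f v = x)
  (fD : {morph f : u v / (u + v)%R >-> mulI u v}) (f0 : f 0%R = '1)
  (fN : {morph f : u / (- u)%R >-> invI u}).

Let posf v : pos (f v). Proof. by apply/f_pos; exists v. Qed.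
Let f_neq0 v : f v <> '0. Proof. exact: pos_neq0. Qed.

Let f_mulrn (v : V) k : f (v *+ k)%R = pw (f v) k.
Proof. by elim: k => [|k IHk] //; rewrite mulrS fD IHk. Qed.

Lemma positive_group_divisible : divisible_torsion_free V.
Proof.
split.
- have /sat_ex[y /sat_and[ym /sat_and[y0 y1]]] := hM M9 z.
  have [/f_pos[u fu]|/(m14 y0)/f_pos[u fu]] := EM (pos y); exists u => u0.
    by apply: y1; rewrite /= -fu u0.
  by apply: ym; rewrite /= -(mK y) -fu u0 f0 m1.
- move=> v k k0 /(congr1 f); rewrite f_mulrn f0 => vk; apply: f_inj; rewrite f0.
  have : pw (f v) (2 * k) = '1 by rewrite mulnC pwM vk /pw /= !m1.
  by move=> /(m11 _ k0)[//|e]; case: (posN pos1); rewrite m1 -e.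
- move=> v k k0; have [y /f_pos[u <-] e] := pos_root k0 (posf v).
  by exists u; apply: f_inj; rewrite f_mulrn.
Qed.

Let phi (x : signed V) : M :=
  match x with
  | None => '0
  | Some (b, v) => if b then f v else 'm ** f v
  end.

Let phi_morph : {morph phi : x y / mulI x y >-> mulI x y}.
Proof.
move=> [[b u]|] [[c v]|] //=; rewrite ?m0 //; last by rewrite mC m0.
case: b c => [] [] /=; rewrite fD //.
- by rewrite [RHS]mA [f u ** 'm]mC mA.
- by rewrite [RHS]mA -['m ** f u ** _]mA [f u ** 'm]mC mK.
Qed.

Let phi_inv : {morph phi : x / invI x >-> invI x}.
Proof.
move=> [[[] u]|] /=; rewrite ?fN ?inv0 //.
have mu : 'm ** f u <> '0 by apply: mul_neq0.
by apply: (mulI_ mu); rewrite mV // -mA [f u ** _]mC -mA [inv _ ** _]mC mV.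
Qed.

Let phi_pos x : posI (phi x) <-> posI x.
Proof.
case: x => [[[] u]|] /=; split=> //.
- by move=> /(posN (posf u)).
- by move=> /pos_neq0.
Qed.

Let phi_inj : injective phi.
Proof.
have a u : 'm ** f u <> '0 by apply: mul_neq0.
have b u v : 'm ** f u <> f v.
  by move=> e; apply: (posN (posf u)); rewrite e.
move=> [[[] u]|] [[[] v]|] //=.
- by move=> /f_inj ->.
- by move=> /esym /b.
- by move=> /f_neq0.
- by move=> /b.
- by move=> /(mulI_ m_neq0) /f_inj ->.
- by move=> /a.
- by move=> /esym /f_neq0.
- by move=> /esym /a.
Qed.

Let phi_surj y : exists x, phi x = y.
Proof.
have [->|y0] := EM (y = '0); first by exists None.
have [/f_pos[u <-]|/(m14 y0)/f_pos[u fu]] := EM (pos y).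
  by exists (Some (true, u)).
by exists (Some (false, u)); rewrite /= fu mK.
Qed.

Lemma signed_isomorphism (e : nat -> M) :
  exists e' : nat -> signed V, forall A, sat e A <-> sat e' A.
Proof.
have [e' ee'] := choice (fun i => phi_surj (e i)).
exists e' => A; have -> : e = fun i => phi (e' i) by apply/funext => i; rewrite ee'.
apply: (sat_iso e' A _ _ _ phi_morph phi_inv phi_pos phi_inj phi_surj) => //=.
by rewrite f0 m1.
Qed.

End Isomorphism.

End ModelStructure.

Lemma model_signed (M : structure) : model_of M axM ->
  exists V : zmodType, divisible_torsion_free V /\
  forall e : nat -> M, exists e' : nat -> signed V, forall A, sat e A <-> sat e' A.
Proof.
move=> hM; have [V [f [f_inj f_pos fD f0 fN]]] := positive_group hM.
exists V; split; first exact: positive_group_divisible f_inj f_pos fD f0.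
exact: signed_isomorphism f_inj f_pos fD f0 fN.
Qed.

(** * The real numbers *)

Section RealModel.
Variable R : realType.
Local Open Scope ring_scope.

Lemma teval_Pow_real (e : nat -> R) t k :
  teval (M := real_structure R) e (Pow t k) = teval (M := real_structure R) e t ^+ k.
Proof.
rewrite /Pow; case: k => // k; rewrite iteropS.
elim: k => [|k IHk]; first by rewrite /= expr1.
by rewrite iterS exprS -IHk.
Qed.

(** By the intermediate value theorem between 0 and x + 1 for nonnegative x, and
    by symmetry for the others. *)
Lemma real_odd_root n (x : R) : exists y, x = y ^+ (2 * n + 1).
Proof.
wlog x0 : x / 0 <= x => [W|].
  have [/W//|/ltW] := leP 0 x; rewrite -oppr_ge0 => /W [y xy].
  by exists (- y); rewrite addn1 mul2n exprNn -signr_odd /= odd_double expr1 mulN1r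
    -[_.+1]addn1 -mul2n -xy opprK.
have [||y _ /rootP] := @poly_ivt R ('X^(2 * n + 1) - x%:P) 0 (x + 1).
- by rewrite addr_ge0.
- rewrite !hornerE addn1 expr0n /= sub0r oppr_le0 x0 /= subr_ge0.
  rewrite exprS; have x1 : 1 <= x + 1 by rewrite lerDr.
  apply: (@le_trans _ _ (x + 1)); first by rewrite lerDl.
  by rewrite ler_peMr ?exprn_ege1 // addr_ge0.
- by rewrite !hornerE => /eqP; rewrite subr_eq0 => /eqP <-; exists y.
Qed.

Lemma real_model : model_of (real_structure R) axM.
Proof.
have nz (x : R) : x <> 0 -> (x == 0) = false by move=> /eqP/negbTE.
move=> A [||||||n n0|n n0|||] e.
- by move=> x y w /=; rewrite mulrA.
- by move=> x /=; rewrite mulr1.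
- by move=> x /= /nz x0; rewrite divff ?x0.
- by move=> x y /=; rewrite mulrC.
- apply/sat_ex; exists (2 : R); rewrite !sat_and /=; split; last first.
    by split=> /eqP; rewrite ?pnatr_eq0 ?pnatr_eq1.
  by move/eqP; rewrite gt_eqF // (@lt_trans _ _ 0) // ?ltrN10 ?ltr0n.
- by move=> x; apply/sat_and; rewrite /= mulr0 invr0.
- move=> x; apply/sat_iff; rewrite sat_or.
  rewrite -[sat _ (Eq (Pow _ _) _)]/(teval (M := real_structure R) _ _ = _).
  rewrite teval_Pow_real /= exprM.
  split=> [/eqP|[->|->]]; last 2 first.
  + by rewrite !expr1n.
  + by rewrite sqrrN !expr1n.
  rewrite pexprn_eq1 ?sqr_ge0 // eqn0Ngt n0 /= sqrf_eq1.
  by case/orP=> /eqP ->; [left|right].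
- move=> x; apply/sat_ex; have [y xy] := real_odd_root n x; exists y.
  rewrite -[sat _ _]/(_ = teval (M := real_structure R) _ (Pow _ _)).
  by rewrite teval_Pow_real.
- move=> x; apply/sat_iff; rewrite sat_ex; split=> [x0|[y /sat_and[/= y0 ->]]].
    have {}x0 : 0 < x by [].
    exists (Num.sqrt x); apply/sat_and; split=> /=.
      by move/eqP; rewrite gt_eqF // sqrtr_gt0.
    by rewrite -expr2 sqr_sqrtr // ltW.
  by rewrite -expr2 exprn_even_gt0 //=; apply/eqP.
- move=> x; apply/sat_imp => x0; apply/sat_iff; rewrite /= mulN1r oppr_gt0; move/nz: x0.
  move=> x0; have [gx|lx|/eqP] := ltgtP 0 x; last by rewrite eq_sym x0.
    by split=> [/(_ isT)|].
  by split.
- apply/sat_all => x; apply/sat_all => y; apply/sat_imp => /sat_and[x0 y0].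
  apply/sat_iff; rewrite sat_iff /=; move: (nz _ x0) (nz _ y0) => /= {}x0 {}y0.
  have [lx|gx|/eqP] := ltgtP x 0; last by rewrite x0.
    rewrite nmulr_rgt0 //; have [ly|gy|/eqP] := ltgtP y 0; last by rewrite y0.
      by split.
    by split=> // -[_ /(_ isT)].
  by rewrite pmulr_rgt0 //; split=> [h|[/(_ isT)]].
Qed.
End RealModel.

(** * Linear relations between exponents *)

Section Lin.
Variable V : zmodType.
Implicit Types (m : nat -> int) (e : nat -> signed V).
Local Open Scope ring_scope.

Definition lin n m e : V := \sum_(i < n) expo (e i) *~ m i.

Lemma lin_scons n m x e :
  lin n.+1 m (scons x e) = expo x *~ m 0%N + lin n (fun i => m i.+1) e.
Proof. by rewrite /lin big_ord_recl. Qed.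

Lemma linD n m1 m2 e : lin n (fun i => m1 i + m2 i) e = lin n m1 e + lin n m2 e.
Proof. by rewrite -big_split; apply: eq_bigr => i _; rewrite mulrzDr. Qed.

Lemma linN n m e : lin n (fun i => - m i) e = - lin n m e.
Proof. by rewrite -sumrN; apply: eq_bigr => i _; rewrite mulrNz. Qed.

Lemma linZ n k m e : lin n (fun i => k * m i) e = lin n m e *~ k.
Proof. by rewrite mulrz_suml; apply: eq_bigr => i _; rewrite -mulrzA mulrC. Qed.

Lemma lin_ext n m1 m2 e :
  (forall i, (i < n)%N -> expo (e i) <> 0 -> m1 i = m2 i) -> lin n m1 e = lin n m2 e.
Proof.
move=> m12; apply: eq_bigr => i _.
by have [->|/eqP/m12->] := eqVneq (expo (e i)) 0; rewrite ?mul0rz.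
Qed.

End Lin.

(** The exponent of the variable [j] in the monomial to which [t] reduces when
    no variable is zero. *)
Fixpoint tdeg (t : term) (j : nat) : int :=
  match t with
  | Var i => (i == j)%:Z
  | Zero | One | MOne => 0
  | Mul s t => tdeg s j + tdeg t j
  | Inv t => - tdeg t j
  end%R.

Fixpoint term_size (t : term) : nat :=
  match t with
  | Var _ => 1
  | Zero | One | MOne => 0
  | Mul s t => term_size s + term_size t
  | Inv t => term_size t
  end.

Fixpoint formula_size (A : formula) : nat :=
  match A with
  | Bot => 0
  | Eq s t => term_size s + term_size t
  | Pos t => term_size t
  | Imp A B => formula_size A + formula_size B
  | All A => (formula_size A).+1
  end.

Lemma tdeg_term_size t j : `|tdeg t j|%N <= term_size t.
Proof. by elim: t => //= [i|s IHs t IHt|t IHt]; [case: eqP|lia|lia]. Qed.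

Lemma expo_teval (V : zmodType) n t (e : nat -> signed V) : tbounded n t ->
  sign (teval e t) <> None -> expo (teval e t) = lin n (tdeg t) e.
Proof.
elim: t => /= [i lt_in _|_ []|_ _|_ _|s IHs t IHt /andP[bs bt]|t IHt bt] //.
- rewrite /lin (bigD1 (Ordinal lt_in)) //= eqxx big1 ?addr0 //.
  move=> j; rewrite -val_eqE /= => /negbTE ij.
  by rewrite eq_sym ij.
- by rewrite /lin big1.
- by rewrite /lin big1.
- move: (IHs bs) (IHt bt); rewrite linD.
  by case: (teval e s) (teval e t) => [[b u]|] [[c v]|] //= -> // ->.
- by move: (IHt bt); rewrite linN; case: (teval e t) => [[b u]|] //= ->.
Qed.

Lemma sign_teval (V W : zmodType) n t (e : nat -> signed V) (e' : nat -> signed W) :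
  tbounded n t -> (forall i, i < n -> sign (e i) = sign (e' i)) ->
  sign (teval e t) = sign (teval e' t).
Proof.
move=> + ss; elim: t => //= [s IHs t IHt /andP[/IHs + /IHt]|t IHt /IHt].
- case: (teval e s) (teval e t) (teval e' s) (teval e' t)
    => [[b u]|] [[c v]|] [[b' u']|] [[c' v']|] //=.
  by move=> [->] [->].
- by case: (teval e t) (teval e' t) => [[b u]|] [[b' u']|] //= [->].
Qed.

(** * Tuples with the same small linear relations *)

(** The invariant of the back-and-forth game between two signed groups; the more
    quantifiers are still to be played, the larger K has to be. *)
Definition linsim (V W : zmodType) n K (e : nat -> signed V) (e' : nat -> signed W) :=
  (forall i, i < n -> sign (e i) = sign (e' i)) /\
  forall m : nat -> int, (forall i, `|m i|%N <= K) ->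
    lin n m e = 0%R <-> lin n m e' = 0%R.

Lemma linsim_sym (V W : zmodType) n K (e : nat -> signed V) (e' : nat -> signed W) :
  linsim n K e e' -> linsim n K e' e.
Proof.
case=> ss ll; split=> [i /ss//|m hm].
by split=> /ll; apply.
Qed.

Lemma linsim_trans (V W X : zmodType) n K (e : nat -> signed V)
    (e' : nat -> signed W) (e'' : nat -> signed X) :
  linsim n K e e' -> linsim n K e' e'' -> linsim n K e e''.
Proof.
case=> ss ll [ss' ll']; split=> [i lt_in|m hm]; first by rewrite ss ?ss'.
by rewrite ll ?ll'.
Qed.

Definition torsion_free (V : zmodType) :=
  forall (v : V) k, 0 < k -> (v *+ k = 0 -> v = 0)%R.

Lemma mulrz_eq0_tf (V : zmodType) (v : V) (k : int) :
  torsion_free V -> k <> 0%R -> (v *~ k = 0 -> v = 0)%R.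
Proof.
move=> tf; case: k => [[|k]|k] // _; first exact: tf.
by rewrite NegzE mulrNz => /eqP; rewrite oppr_eq0 => /eqP /tf; apply.
Qed.

Section Extension.
Variables (V W : zmodType) (tfV : torsion_free V) (tfW : torsion_free W).
Variables (n K : nat) (K0 : 0 < K) (e : nat -> signed V) (e' : nat -> signed W).
Hypothesis see' : linsim n (2 * K ^ 2) e e'.
Local Open Scope ring_scope.

Let le_K : (K <= 2 * K ^ 2)%N.
Proof. by rewrite expnS expn1; nia. Qed.

Lemma linsim_scons_sign x y : sign x = sign y ->
  (forall (k : int) (m : nat -> int), (`|k| <= K)%N -> (forall i, `|m i| <= K)%N ->
     k <> 0 -> expo x *~ k + lin n m e = 0 <-> expo y *~ k + lin n m e' = 0) ->
  linsim n.+1 K (scons x e) (scons y e').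
Proof.
case: see' => ss ll sxy hxy; split=> [[|i] //= /ss //|m hm].
rewrite !lin_scons; have [m0|/eqP m0] := eqVneq (m 0%N) 0.
  rewrite m0 !mulr0z !add0r; apply: ll => i; exact: leq_trans (hm _) le_K.
by apply: hxy => // i; apply: hm.
Qed.

Lemma linsim_scons_zero : linsim n.+1 K (scons None e) (scons None e').
Proof.
apply: linsim_scons_sign => // k m _ hm _; rewrite !mul0rz !add0r.
by case: see' => _; apply => i; apply: leq_trans (hm i) le_K.
Qed.

(** When x solves k x + lin m = 0, any other relation k2 x + lin m2 = 0 holds
    iff the resultant k lin m2 - k2 lin m vanishes, whose coefficients are
    bounded by 2 K^2. *)
Lemma linsim_scons_root b v w (k : int) (m : nat -> int) :
  (`|k| <= K)%N -> (forall i, `|m i| <= K)%N -> k <> 0 ->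
  v *~ k + lin n m e = 0 -> w *~ k + lin n m e' = 0 ->
  linsim n.+1 K (scons (Some (b, v)) e) (scons (Some (b, w)) e').
Proof.
move=> hk hm k0 rv rw; apply: linsim_scons_sign => // k2 m2 hk2 hm2 _ /=.
pose r i := k * m2 i + - (k2 * m i).
have E (U : zmodType) (u : U) (f : nat -> signed U) : torsion_free U ->
    u *~ k + lin n m f = 0 -> u *~ k2 + lin n m2 f = 0 <-> lin n r f = 0.
  move=> tf ru; have uk : u *~ k = - lin n m f by apply/eqP; rewrite -addr_eq0 ru.
  have -> : lin n r f = (u *~ k2 + lin n m2 f) *~ k.
    rewrite /r linD linN !linZ mulrzDl -mulrzA mulrC mulrzA uk mulNrz.
    by rewrite addrC.
  by split=> [->|/mulrz_eq0_tf]; [rewrite mul0rz|apply].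
rewrite (E _ _ _ tfV rv) (E _ _ _ tfW rw); case: see' => _; apply => i.
rewrite /r expnS expn1; have := hm i; have := hm2 i; nia.
Qed.

Lemma linsim_scons_generic b v w :
  (forall (k : int) (m : nat -> int), (`|k| <= K)%N -> (forall i, `|m i| <= K)%N ->
     k <> 0 -> v *~ k + lin n m e <> 0 /\ w *~ k + lin n m e' <> 0) ->
  linsim n.+1 K (scons (Some (b, v)) e) (scons (Some (b, w)) e').
Proof.
move=> hvw; apply: linsim_scons_sign => // k m hk hm k0.
by have [] := hvw k m hk hm k0.
Qed.

End Extension.

(** * The game between a model and bounded integers *)

(** The small coefficient vectors have to be enumerated, for counting and for
    listing formulas; shifting their entries by K puts them in a finite type. *)
Definition ffun_coef n K (f : {ffun 'I_n -> 'I_(2 * K).+1}) (i : nat) : int :=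
  if insub i is Some j then ((f j : nat)%:Z - K%:Z)%R else 0%R.

Lemma ffun_coef_surj n K (m : nat -> int) : (forall i, `|m i|%N <= K) ->
  exists f, forall i, i < n -> @ffun_coef n K f i = m i.
Proof.
move=> hm; exists [ffun i : 'I_n => inord `|(m i + K%:Z)%R|%N] => i lt_in.
rewrite /ffun_coef insubT ffunE /= inordK; have := hm i; lia.
Qed.

Section GenericElement.
Variable V : zmodType.
Hypothesis V_dtf : divisible_torsion_free V.
Local Open Scope ring_scope.

Lemma dtf_torsion_free : torsion_free V. Proof. by case: V_dtf. Qed.

Lemma dtf_div (k : int) (v : V) : k <> 0 -> exists u, u *~ k = v.
Proof.
case: V_dtf => _ _ dv; case: k => [[|k]|k] // _; first exact: dv.
by have [//|u uk] := dv (- v) k.+1; exists u; rewrite NegzE mulrNz -pmulrn uk opprK.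
Qed.

(** Each relation holds for at most one multiple of a nonzero u, so that by
    counting some multiple satisfies none of them. *)
Lemma generic_element n K (e : nat -> signed V) : exists v : V,
  forall (k : int) (m : nat -> int), (`|k| <= K)%N -> (forall i, `|m i| <= K)%N ->
    k <> 0 -> v *~ k + lin n m e <> 0.
Proof.
have [[u u0] tf _] := V_dtf; apply: contrapT => /forallNP nog.
pose I := {ffun 'I_n.+1 -> 'I_(2 * K).+1}.
have root j : exists f : I, ffun_coef f n <> 0 /\
    u *~ j%:Z *~ ffun_coef f n + lin n (ffun_coef f) e = 0.
  have := nog (u *~ j%:Z) => /existsNP[k /existsNP[m]].
  move=> /not_implyP[hk /not_implyP[hm /not_implyP[k0 /contrapT r]]].
  have [i|f ef] := @ffun_coef_surj n.+1 K (fun i => if (i < n)%N then m i else k).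
    by case: ifP.
  exists f; rewrite ef ?ltnn //; split=> //.
  rewrite -[RHS]r; congr (_ + _); apply: lin_ext => i lt_in _.
  by rewrite ef ?lt_in // ltnW.
have [g gP] := choice root.
suff : injective (fun j : 'I_#|{: I}|.+1 => g j).
  by move=> /leq_card; rewrite card_ord ltnn.
move=> i j gij; have [gi0 ri] := gP i; have [_ rj] := gP j.
apply: val_inj; move: rj; rewrite -gij => rj.
have : u *~ (i%:Z - j%:Z) *~ ffun_coef (g i) n = 0.
  by rewrite mulrzBr mulrzBl; apply/eqP; rewrite subr_eq0;
    apply/eqP/(addIr (lin n (ffun_coef (g i)) e)); rewrite ri rj.
move=> /(mulrz_eq0_tf tf gi0) h; apply: contrapT => ij; apply: u0.
by apply: (mulrz_eq0_tf tf _ h) => /eqP; rewrite subr_eq0 => /eqP [].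
Qed.

End GenericElement.

(** The constants of the game, as functions of a bound c on the size of the
    formula and on the number of variables.  With d rounds to go, coefficients
    up to [cbound c d] matter; the integer exponents in play are multiples of
    [modulus c ^ d] and at most [modulus c ^ (2 * c - d)].  Cubing the bound in every
    round gives room for the factor 2 in 2 B^2. *)
Definition cbound c d := (2 * c + 2) ^ (3 ^ d).
Definition modulus c := (c.+1 * cbound c c)`!.
Definition in_range c d (x : signed int) : Prop :=
  modulus c ^ d %| `|expo x|%N /\ `|expo x|%N <= modulus c ^ (2 * c - d).

Lemma cbound_gt0 c d : 0 < cbound c d.
Proof. by rewrite expn_gt0 addn2. Qed.

Lemma cbound_mono c d d' : d <= d' -> cbound c d <= cbound c d'.
Proof. by move=> le_dd'; rewrite leq_pexp2l ?addn2 // leq_pexp2l. Qed.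

Lemma cboundS c d : 2 * cbound c d ^ 2 <= cbound c d.+1.
Proof.
have -> : cbound c d.+1 = cbound c d ^ 3 by rewrite /cbound expnS [3 * _]mulnC expnM.
rewrite [in leqRHS]expnS leq_mul2r; apply/orP; right.
by apply: leq_trans (leq_pexp2l _ (expn_gt0 3 d : 0 < 3 ^ d)); rewrite ?expn1; lia.
Qed.

Lemma modulus_dvd c k : 0 < k -> k <= cbound c c -> k %| modulus c.
Proof.
move=> k0 hk; apply: dvdn_fact; rewrite k0 /=; apply: leq_trans hk _.
exact: leq_pmull.
Qed.

Lemma modulus_gt c : c * cbound c c < modulus c.
Proof.
apply: leq_trans (fact_geq _); rewrite ltn_mul2r cbound_gt0; exact: ltnSn.
Qed.

Lemma in_range_zero c d : in_range c d None.
Proof. by split; rewrite //= dvdn0. Qed.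

Lemma modulus_gt0 c : 0 < modulus c.
Proof. exact: fact_gt0. Qed.

Lemma in_range_weak c d x : in_range c d.+1 x -> in_range c d x.
Proof.
case=> dv le; split; first by apply: dvdn_trans dv; rewrite expnS dvdn_mull.
apply: leq_trans le _; apply: leq_pexp2l (modulus_gt0 c) _; lia.
Qed.

Lemma lin_dvd n m q (e : nat -> signed int) :
  (forall i, i < n -> q %| `|expo (e i)|%N) -> q %| `|lin n m e|%N.
Proof.
move=> qe; rewrite -[q]/(`|Posz q|%N) -dvdzE /lin.
apply: (big_ind (fun x => (Posz q %| x)%Z)); first exact: dvdz0.
  by move=> x y; apply: rpredD.
by move=> i _; rewrite mulrzz; apply: dvdz_mulr; rewrite dvdzE qe.
Qed.

Lemma lin_le n m K U (e : nat -> signed int) : (forall i, `|m i|%N <= K) ->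
  (forall i, i < n -> `|expo (e i)|%N <= U) -> `|lin n m e|%N <= n * (K * U).
Proof.
move=> hm; elim: n m e hm => [|n IHn] m e hm he; first by rewrite /lin big_ord0.
rewrite /lin big_ord_recl /= -[X in (_ + X)%R]/(lin n (fun i => m i.+1) (fun i => e i.+1)).
have := IHn (fun i => m i.+1) (fun i => e i.+1) (fun i => hm i.+1) (fun i => he i.+1).
have := hm 0; have := he 0 isT; rewrite mulrzz; nia.
Qed.

(** One round of the game, between n-tuples e and z that are already played. *)
Section Game.
Variables (V : zmodType) (V_dtf : divisible_torsion_free V).
Variables (c n d : nat) (hnd : n + d.+1 <= c).
Variables (e : nat -> signed V) (z : nat -> signed int).
Hypothesis sez : linsim n (cbound c d.+1) e z.

Let K := cbound c d.
Let tfV : torsion_free V. Proof. exact: dtf_torsion_free. Qed.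
Let tfZ : torsion_free int. Proof. by move=> v k k0 /eqP; rewrite mulrn_eq0; case: k k0 => //= k _ /eqP. Qed.
Let sez' : linsim n (2 * K ^ 2) e z.
Proof.
case: sez => ss ll; split=> // m hm; apply: ll => i.
exact: leq_trans (hm i) (cboundS c d).
Qed.

Let K0 : 0 < K. Proof. exact: cbound_gt0. Qed.

(** A root of an equation over z is answered by the root of the corresponding
    equation over e, which V has as it is divisible. *)
Lemma game_back (y : signed int) :
  exists x : signed V, linsim n.+1 K (scons x e) (scons y z).
Proof.
case: y => [[b w]|]; last by exists None; apply: linsim_scons_zero.
have [[k [m [hk hm k0 rw]]]|nor] := EM (exists (k : int) (m : nat -> int),
    [/\ `|k|%N <= K, forall i, `|m i|%N <= K, k <> 0%R & (w *~ k + lin n m z)%R = 0%R]).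
  have [v vk] := dtf_div V_dtf (- lin n m e)%R k0.
  exists (Some (b, v)); apply: (linsim_scons_root tfV tfZ K0 sez' b hk hm k0) => //.
  by rewrite vk addNr.
have [v gv] := generic_element V_dtf n K e.
exists (Some (b, v)); apply: (linsim_scons_generic K0 sez').
move=> k m hk hm k0; split; first exact: gv.
by move=> r; apply: nor; exists k, m.
Qed.

Hypothesis rz : forall i, i < n -> in_range c d.+1 (z i).

(** The integer root of k w + l = 0 exists: the exponents of z are multiples of
    F^(d+1) with k dividing F, so l is a multiple of k F^d.  The largest exponent
    in range is generic, as it exceeds |l|, which is at most n K times the bound on
    the exponents of z. *)
Lemma game_forth (x : signed V) :
  exists y : signed int, in_range c d y /\ linsim n.+1 K (scons x e) (scons y z).
Proof.
case: x => [[b v]|]; last first.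
  by exists None; split; [apply: in_range_zero|apply: linsim_scons_zero].
pose F := modulus c; pose U := F ^ (2 * c - d.+1).
have F0 : 0 < F := modulus_gt0 c.
have U0 : 0 < U by rewrite expn_gt0 F0.
have US : F ^ (2 * c - d) = F * U by rewrite -expnS; congr (_ ^ _); lia.
have KK : K <= cbound c c by apply: cbound_mono; lia.
have nKF : n * K < F.
  by apply: leq_ltn_trans (modulus_gt c); apply: leq_mul => //; lia.
have linU m : (forall i, `|m i|%N <= K) -> `|lin n m z|%N <= n * (K * U).
  by move=> hm; apply: lin_le => // i /rz[].
have [[k [m [hk hm k0 rv]]]|nor] := EM (exists (k : int) (m : nat -> int),
    [/\ `|k|%N <= K, forall i, `|m i|%N <= K, k <> 0%R & (v *~ k + lin n m e)%R = 0%R]).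
  have kF : `|k|%N %| F by apply: modulus_dvd; [lia|apply: leq_trans KK].
  have /dvdnP[q lq] : `|k|%N * F ^ d %| `|lin n m z|%N.
    apply: lin_dvd => i /rz[+ _]; apply: dvdn_trans.
    by rewrite expnS dvdn_pmul2r // expn_gt0 F0.
  (* The integer - l / k, where the absolute value of l is q * (|k| * F ^ d). *)
  pose w : int := (- (sgz k * sgz (lin n m z)) * (q * F ^ d)%:Z)%R.
  have wk : (w *~ k + lin n m z)%R = 0%R.
    rewrite mulrzz /w [X in (_ + X)%R]intEsg lq [X in (_ * X)%R](intEsg k).
    have : (sgz k * sgz k = 1)%R by case: sgzP k0 => // ->.
    rewrite !PoszM; nia.
  exists (Some (b, w)); split; last first.
    exact: (linsim_scons_root tfV tfZ K0 sez' b hk hm k0).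
  have absw : `|w|%N * `|k|%N = `|lin n m z|%N.
    have /(congr1 absz) : (w * k = - lin n m z)%R.
      by apply/eqP; rewrite -addr_eq0 -mulrzz wk.
    by rewrite abszM abszN.
  have k1 : 0 < `|k|%N by lia.
  split.
    rewrite -(dvdn_pmul2r k1) /= absw lq mulnC; exact: dvdn_mull.
  rewrite /= US; apply: leq_trans (_ : `|w|%N * `|k|%N <= _); first exact: leq_pmulr.
  rewrite absw; apply: leq_trans (linU _ hm) _; rewrite mulnA leq_mul2r; lia.
pose w : int := (F ^ (2 * c - d))%:Z.
exists (Some (b, w)); split.
  by split; rewrite /= ?leqnn // dvdn_exp2l //; lia.
apply: (linsim_scons_generic K0 sez') => k m hk hm k0; split.
  by move=> r; apply: nor; exists k, m.
move=> r; have := linU _ hm.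
have -> : `|lin n m z|%N = `|w|%N * `|k|%N.
  have /(congr1 absz) : (w * k = - lin n m z)%R.
    by apply/eqP; rewrite -addr_eq0 -mulrzz r.
  by rewrite abszM abszN => ->.
have k1 : 0 < `|k|%N by lia.
rewrite /w US mulnA /=; apply/negP; rewrite -ltnNge.
apply: leq_trans (_ : F * U <= _); last exact: leq_pmulr.
by rewrite ltn_pmul2r.
Qed.

End Game.

(** The game played on the side of the integers alone; every quantifier ranges
    over a finite set. *)
Fixpoint bsat c d (z : nat -> signed int) (A : formula) : Prop :=
  match A with
  | Bot => False
  | Eq s t => teval z s = teval z t
  | Pos t => posI (teval z t)
  | Imp A B => bsat c d z A -> bsat c d z B
  | All A => forall y, in_range c d.-1 y -> bsat c d.-1 (scons y z) A
  end.

Section Transfer.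
Variables (V : zmodType) (V_dtf : divisible_torsion_free V).

(** Atomic formulas compare signs and exponents, and exponents of terms are linear
    combinations small enough for [linsim]; quantifiers are the two halves of the
    round. *)
Theorem sat_bsat A c n d (e : nat -> signed V) (z : nat -> signed int) :
  bounded n A -> formula_size A <= d -> n + d <= c ->
  linsim n (cbound c d) e z -> (forall i, i < n -> in_range c d (z i)) ->
  sat e A <-> bsat c d z A.
Proof.
elim: A n d e z => /= [|s t|t|A IHA B IHB|A IHA] n d e z.
- by [].
- move=> /andP[bs bt] hs hc [ss ll] _; rewrite !signed_eq.
  rewrite (sign_teval bs ss) (sign_teval bt ss).
  have [est|?] := EM (sign (teval (M := signed int) z s) = sign (teval (M := signed int) z t)); last by split=> [] [].
  have [z0|nz] := EM (sign (teval (M := signed int) z s) = None); first by split=> _; split.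
  have nzt : sign (teval (M := signed int) z t) <> None by rewrite -est.
  have nes : sign (teval (M := signed V) e s) <> None by rewrite (sign_teval bs ss).
  have net : sign (teval (M := signed V) e t) <> None by rewrite (sign_teval bt ss).
  rewrite !(expo_teval bs) // !(expo_teval bt) //.
  have := ll (fun i => tdeg s i + - tdeg t i)%R; rewrite !linD !linN.
  move=> [i|h1 h2].
    have := tdeg_term_size s i; have := tdeg_term_size t i => h1 h2.
    apply: leq_trans (_ : 2 * c + 2 <= _); first by lia.
    by rewrite -[leqLHS]expn1 leq_pexp2l ?addn2 // expn_gt0.
  split=> -[_ h]; split=> // _; apply/eqP; rewrite -subr_eq0; apply/eqP.
    by apply: h1; rewrite h // subrr.
  by apply: h2; rewrite h // subrr.
- move=> bt _ _ [ss _] _; have := sign_teval bt ss.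
  by case: (teval (M := signed V) e t) (teval (M := signed int) z t) => [[[] u]|] [[[] v]|].
- move=> /andP[bA bB] hs hc sez rz.
  by rewrite (IHA n d e z) ?(IHB n d e z) //; lia.
- case: d => // d bA hs hc sez rz; split=> h x => [rx|] /=.
    have [y sy] := game_back V_dtf sez x.
    rewrite -(IHA n.+1 d (scons y e)) //; first by lia.
    by move=> [|i] //= /rz /in_range_weak.
  have [y [ry sy]] := game_forth V_dtf hc sez rz x.
  rewrite (IHA n.+1 d _ (scons y z)) //; [exact: h|lia|].
  by move=> [|i] //= /rz /in_range_weak.
Qed.

Lemma linsim_nil K (W : zmodType) (e : nat -> signed V) (z : nat -> signed W) :
  linsim 0 K e z.
Proof. by split=> // m _; rewrite /lin !big_ord0. Qed.

(** The integer tuple is found by letting e be played one element at a time. *)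
Lemma linsim_exists c n d (e : nat -> signed V) : n + d <= c ->
  exists z : nat -> signed int,
    (forall i, i < n -> in_range c d (z i)) /\ linsim n (cbound c d) e z.
Proof.
elim: n d e => [|n IHn] d e hc.
  by exists (fun=> None); split=> //; apply: linsim_nil.
rewrite addSnnS in hc.
have [z [rz sz]] := IHn d.+1 (fun i => e i.+1) hc.
have [y [ry sy]] := game_forth V_dtf hc sz rz (e 0).
exists (scons y z); split; first by move=> [|i] //= /rz /in_range_weak.
suff -> : e = scons (e 0) (fun i => e i.+1) by [].
by apply/funext => -[|i].
Qed.

End Transfer.

Corollary linsim_sat (V W : zmodType) A n (e : nat -> signed V) (e' : nat -> signed W) :
  divisible_torsion_free V -> divisible_torsion_free W -> bounded n A ->
  linsim n (cbound (n + formula_size A) (formula_size A)) e e' -> sat e A <-> sat e' A.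
Proof.
move=> dV dW bA see'; have [z [rz sz]] := linsim_exists dV e (leqnn (n + formula_size A)).
rewrite (sat_bsat dV bA _ _ sz rz) // (sat_bsat dW bA _ _ _ rz) //.
by apply: linsim_trans sz; apply: linsim_sym.
Qed.

(** * Quantifier elimination *)

Definition tpow (t : term) k : term := iter k (Mul t) One.

(** Squaring all the factors removes the signs, so that the equation with 1 states
    a linear relation between exponents. *)
Definition monomial (m : nat -> int) (s : seq nat) : term :=
  foldr (fun i t =>
    Mul (tpow (if m i is Posz _ then Var i else Inv (Var i)) (2 * `|m i|)) t) One s.

Definition atoms n K : seq formula :=
  [seq Eq (Var i) Zero | i <- iota 0 n] ++ [seq Pos (Var i) | i <- iota 0 n] ++
  [seq Eq (monomial (ffun_coef f) (iota 0 n)) One | f : {ffun 'I_n -> 'I_(2 * K).+1}].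

Lemma teval_monomial (V : zmodType) m s (e : nat -> signed V) :
  (forall i, i \in s -> m i <> 0%R -> sign (e i) <> None) ->
  teval e (monomial m s) = Some (true, \sum_(i <- s) expo (e i) *~ m i *+ 2)%R.
Proof.
have tp t k b v : teval e t = Some (b, v) :> signed V ->
    teval e (tpow t (2 * k)) = Some (true, v *+ k *+ 2)%R :> signed V.
  move=> et; rewrite -mulrnA [k * 2]mulnC.
  elim: k => // k IHk; rewrite mulnS /tpow iterD -/(tpow t _) /= et IHk.
  by rewrite [(2 + _)%N]addnC mulrnDr mulr2n addrC -addrA /=; case: b {et}.
elim: s => [|i s IHs] hs; first by rewrite /= big_nil.
have fi : teval e (tpow (if m i is Posz _ then Var i else Inv (Var i)) (2 * `|m i|)) =
    Some (true, expo (e i) *~ m i *+ 2)%R :> signed V.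
  have [->|m0] := EM (m i = 0%R); first by rewrite /= mulr0z mul0rn.
  have : sign (e i) <> None by apply: hs => //; exact: mem_head.
  case ei: (e i) => [[b v]|] // _; case: (m i) => k; first exact: (tp _ _ b v).
  rewrite (tp _ _ b (- v)%R) /= ?ei //.
  by rewrite NegzE mulrNz -pmulrn mulNrn.
rewrite big_cons -[LHS]/(mulI (s := signed V) (teval e (tpow _ _)) (teval e (monomial m s))).
by rewrite fi IHs // => j js; apply: hs; rewrite in_cons js orbT.
Qed.

(** A zero variable contributes nothing to a linear relation, but would annihilate
    the monomial; hence its coefficient is replaced by 0 first. *)
Lemma agree_atoms (V W : zmodType) n K (e : nat -> signed V) (e' : nat -> signed W) :
  torsion_free V -> torsion_free W ->
  (forall a, List.In a (atoms n K) -> sat e a <-> sat e' a) -> linsim n K e e'.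
Proof.
move=> tfV tfW h.
have In_iota i : i < n -> List.In i (iota 0 n).
  move=> lt_in; have : i \in iota 0 n by rewrite mem_iota.
  elim: (iota 0 n) => //= j s IHs; rewrite in_cons => /orP[/eqP->|/IHs]; by [left|right].
have ss i : i < n -> sign (e i) = sign (e' i).
  move=> /In_iota lt_in.
  have E0 : e i = None <-> e' i = None.
    apply: (h (Eq (Var i) Zero)); apply/List.in_or_app; left.
    exact: (List.in_map (fun i => Eq (Var i) Zero)).
  have E1 : posI (e i) <-> posI (e' i).
    apply: (h (Pos (Var i))); apply/List.in_or_app; right.
    by apply/List.in_or_app; left; apply: (List.in_map (fun i => Pos (Var i))).
  move: E0 E1; case: (e i) (e' i) => [[[] u]|] [[[] v]|] //= [h1 h2] [h3 h4];
    first [by case: (h3 I)|by case: (h4 I)|by have := h1 erefl|by have := h2 erefl].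
split=> // m hm.
pose m' i : int := if sign (e i) is None then 0%R else m i.
have [i|f ef] := @ffun_coef_surj n K m'; first by rewrite /m'; case: (sign _).
have Ee : lin n m e = lin n (ffun_coef f) e.
  by apply: lin_ext => i lt_in; rewrite ef // /m'; case: (e i) => [[b u]|].
have Ee' : lin n m e' = lin n (ffun_coef f) e'.
  by apply: lin_ext => i lt_in; rewrite ef // /m' ss //; case: (e' i) => [[b u]|].
have /h /= : List.In (Eq (monomial (ffun_coef f) (iota 0 n)) One) (atoms n K).
  apply/List.in_or_app; right; apply/List.in_or_app; right.
  apply: (List.in_map (fun f => Eq (monomial (ffun_coef f) (iota 0 n)) One)).
  have : f \in enum {: {ffun 'I_n -> 'I_(2 * K).+1}} by rewrite mem_enum.
  by elim: (enum _) => //= g s IHs; rewrite in_cons => /orP[/eqP->|/IHs]; [left|right].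
have lin2 (X : zmodType) (g : nat -> signed X) : torsion_free X ->
    (forall i, i < n -> sign (g i) = None -> m' i = 0%R) ->
    sat g (Eq (monomial (ffun_coef f) (iota 0 n)) One) <->
    lin n (ffun_coef f) g = 0%R.
  move=> tf hg; rewrite -[sat _ _]/(teval (M := signed X) g _ = Some (true, 0%R)).
  rewrite teval_monomial => [|i]; last first.
    by rewrite mem_iota => lt_in; rewrite ef // => m0 /(hg _ lt_in).
  rewrite -[in iota 0 n](subn0 n) -/(index_iota 0 n) sumrMnl big_mkord -/(lin _ _ _).
  by split=> [[]|->]; [apply: tf|rewrite mul0rn].
rewrite Ee Ee' -lin2 // => [|i lt_in]; last by rewrite /m' => ->.
by rewrite -lin2 // => i lt_in; rewrite /m' ss // => ->.
Qed.

(** By Shannon expansion on the first formula a of the list: Q holds iff a and Q1 or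
    not a and Q0 hold, where Q1 and Q0 ask for Q in some model that agrees on the
    rest of the list and in which a is true or false, respectively. *)
Lemma shannon_expansion (T : theory) n (L : seq formula)
    (Q : forall M : structure, (nat -> M) -> Prop) :
  (forall a, List.In a L -> quantifier_free a /\ bounded n a) ->
  (forall (M N : structure) (e : nat -> M) (e' : nat -> N),
     model_of M T -> model_of N T ->
     (forall a, List.In a L -> sat e a <-> sat e' a) -> Q M e -> Q N e') ->
  exists B, [/\ quantifier_free B, bounded n B &
    forall (M : structure) (e : nat -> M), model_of M T -> sat e B <-> Q M e].
Proof.
elim: L Q => [|a L IHL] Q hL hQ.
  have [[M [e [hM hMe]]]|noM] :=
    EM (exists (M : structure) (e : nat -> M), model_of M T /\ Q M e).
    exists (Imp Bot Bot); split=> // N e' hN; split=> [_|_ []].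
    by apply: (hQ M N e e').
  exists Bot; split=> // M e hM; split=> // hMe.
  by apply: noM; exists M, e.
pose Qa (P : Prop) (M : structure) (e : nat -> M) :=
  exists (N : structure) (e' : nat -> N), [/\ model_of N T,
    forall b, List.In b L -> sat e b <-> sat e' b, sat e' a <-> P & Q N e'].
have step P : exists B, [/\ quantifier_free B, bounded n B &
    forall (M : structure) (e : nat -> M), model_of M T -> sat e B <-> Qa P M e].
  apply: IHL => [b Lb|M N e e' hM hN ee' [X [e'' [hX ee'' aP QX]]]].
    by apply: hL; right.
  exists X, e''; split=> // b Lb.
  exact: iff_trans (iff_sym (ee' b Lb)) (ee'' b Lb).
have [qa ba] := hL a (or_introl erefl).
have [B1 [q1 b1 h1]] := step True; have [B0 [q0 b0 h0]] := step False.
exists (Or (And a B1) (And (Neg a) B0)); split.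
- by rewrite /= qa q1 q0.
- by rewrite /= ba b1 b0.
move=> M e hM; rewrite sat_or !sat_and h1 // h0 // sat_neg.
split=> [[[ea]|[ea]] [N [e' [hN ee' aP QN]]]|QM].
- apply: (hQ N M e' e) => // b [<-|/ee' h]; last exact: iff_sym.
  by split=> // _; apply/aP.
- apply: (hQ N M e' e) => // b [<-|/ee' h]; last exact: iff_sym.
  by split=> // /aP.
- have [ea|ea] := EM (sat e a); [left|right]; split=> //; exists M, e; split=> //.
Qed.

Lemma sentence_axM A : axM A -> sentence A.
Proof.
have bP n i k : i < n -> tbounded n (Pow (Var i) k).
  move=> lt_in; rewrite /Pow; case: k => // k; rewrite iteropS.
  by elim: k => [|k] //= ->; rewrite lt_in.
by case=> // n n0; rewrite /sentence /= !bP.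
Qed.

Lemma atoms_bounded n K a : List.In a (atoms n K) -> quantifier_free a /\ bounded n a.
Proof.
have In_iota i : List.In i (iota 0 n) -> i < n.
  move=> Ii; have : i \in iota 0 n; last by rewrite mem_iota.
  elim: (iota 0 n) Ii => //= j s IHs [->|/IHs]; rewrite in_cons ?eqxx // => ->.
  exact: orbT.
have btp t k : tbounded n t -> tbounded n (tpow t k).
  by move=> bt; elim: k => //= k ->; rewrite bt.
have bm m s : (forall i, List.In i s -> i < n) -> tbounded n (monomial m s).
  elim: s => //= i s IHs hs; apply/andP; split; last by apply: IHs => j Ij; apply: hs; right.
  by apply: btp; case: (m i) => k /=; apply: hs; left.
move=> /(List.in_app_or _ _ _)[h|/(List.in_app_or _ _ _)[h|h]].
- have [i [<- /In_iota lt_in]] := (List.in_map_iff _ _ _).1 h.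
  by rewrite /= lt_in.
- by have [i [<- /In_iota lt_in]] := (List.in_map_iff _ _ _).1 h.
- have [f [<- _]] := (List.in_map_iff _ _ _).1 h.
  by split=> //=; rewrite bm.
Qed.

Lemma prv_axM A : (forall (M : structure) (e : nat -> M), model_of M axM -> sat e A) ->
  prv axM A.
Proof.
move=> hA; apply: (@completeness axM 0) => [B /sentence_axM//|M e he].
apply: hA => B TB e'; apply/(sat_bounded (sentence_axM TB)); last exact: he TB.
by [].
Qed.

Theorem axM_admits_QE : admits_QE axM.
Proof.
move=> n A bA; pose K := cbound (n + formula_size A) (formula_size A).
have [M N e e' hM hN ee'|B [qB bB hB]] :=
  @shannon_expansion axM n _ (fun M e => sat e A) (@atoms_bounded n K).
- have [V [dV /(_ e)[eV hV]]] := model_signed hM.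
  have [W [dW /(_ e')[eW hW]]] := model_signed hN.
  rewrite hV hW => sA; suff /(linsim_sat dV dW bA) <- : linsim n K eV eW by [].
  apply: agree_atoms; [exact: dtf_torsion_free|exact: dtf_torsion_free|].
  by move=> a /ee'; rewrite hV hW.
- exists B; split=> //; apply: prv_axM => M e hM; apply/sat_iff.
  by have [h1 h2] := hB M e hM; split.
Qed.

(** * Completeness of the axioms *)

Lemma models_equivalent (M N : structure) (e : nat -> M) (e' : nat -> N) A :
  model_of M axM -> model_of N axM -> sentence A -> sat e A <-> sat e' A.
Proof.
move=> hM hN sA; have [V [dV /(_ e)[eV hV]]] := model_signed hM.
have [W [dW /(_ e')[eW hW]]] := model_signed hN.
rewrite hV hW; apply: (linsim_sat (n := 0)) => //; exact: linsim_nil.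
Qed.

Theorem axM_complete (R : realType) : completely_axiomatizes axM (real_structure R).
Proof.
move=> A sA; split=> [RA|/soundness h e]; last first.
  by apply: h => B TB; apply: real_model.
apply: prv_axM => M e hM.
exact/(models_equivalent e (fun=> 0%R : real_structure R) hM (@real_model R) sA)/RA.
Qed.

Lemma Th_real_admits_QE (R : realType) : admits_QE (Th (real_structure R)).
Proof.
move=> n A bA; have [B [qB bB pB]] := axM_admits_QE bA.
exists B; split=> //; apply: prv_weak pB _ => C TC; split; first exact: sentence_axM.
by move=> e; apply: real_model.
Qed.

(** Any model relates provability to [bsat]; the reals are one. *)
Lemma axM_bsat (R : realType) c A : sentence A -> formula_size A <= c ->
  prv axM A <-> bsat c c (fun=> None) A.
Proof.
move=> sA hA; rewrite -(axM_complete R) //; pose e0 : nat -> real_structure R := fun=> 0%R.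
have [V [dV /(_ e0)[eV hV]]] := model_signed (@real_model R).
have <- : sat e0 A <-> bsat c c (fun=> None) A.
  by rewrite hV; apply: (sat_bsat dV sA) => //; exact: linsim_nil.
split=> [/(_ e0)//|h e].
have [//|h1 _] := @sat_bounded _ 0 A e0 e sA; exact: h1.
Qed.

(** * Recursive functions *)

(** Arguments are read off an environment, so that closure properties can be
    stated without tuples; the arguments beyond the n-th are 0. *)
Definition Rec n (F : (nat -> nat) -> nat) : Prop :=
  recursive (fun v : n.-tuple nat => F (nth 0 v)).

Lemma Rec_ext n F G : (forall v : n.-tuple nat, F (nth 0 v) = G (nth 0 v)) ->
  Rec n F -> Rec n G.
Proof. by move=> FG; rewrite /Rec; have -> := funext FG. Qed.

Lemma Rec_zero n : Rec n (fun=> 0).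
Proof. exact: rec_zero. Qed.

Lemma Rec_var n i : Rec n (fun e => e i).
Proof.
have [lt_in|le_ni] := ltnP i n.
  rewrite /Rec; have := rec_proj (Ordinal lt_in).
  by congr recursive; apply/funext => v; rewrite (tnth_nth 0).
apply: Rec_ext (Rec_zero n) => v.
by rewrite nth_default // size_tuple.
Qed.

Lemma Rec_comp m n H (G : nat -> (nat -> nat) -> nat) :
  Rec m H -> (forall i, Rec n (G i)) ->
  Rec n (fun e => H (fun i => if i < m then G i e else 0)).
Proof.
move=> rH rG; have := rec_comp rH (g := fun i v => G i (nth 0 v)) (fun i => rG i).
congr recursive; apply/funext => v; congr H; apply/funext => i.
case: ltnP => [lt_im|le_mi]; last by rewrite nth_default // size_tuple.
by rewrite (nth_mktuple _ 0 (Ordinal lt_im)).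
Qed.

Lemma Rec_succ n F : Rec n F -> Rec n (fun e => (F e).+1).
Proof.
move=> rF; have r1 : Rec 1 (fun e => (e 0).+1).
  have := rec_succ; congr recursive; apply/funext => v.
  by rewrite /thead (tnth_nth 0).
exact: (Rec_comp r1 (fun=> rF)).
Qed.

Lemma Rec_const n c : Rec n (fun=> c).
Proof. by elim: c => [|c IHc]; [exact: Rec_zero|exact: Rec_succ]. Qed.

Lemma nth_scons k n (v : n.-tuple nat) : nth 0 [tuple of k :: v] = scons k (nth 0 v).
Proof. by apply/funext => -[|i]. Qed.

Lemma Rec_scons n F K : Rec n.+1 F -> Rec n K -> Rec n (fun e => F (scons (K e) e)).
Proof.
move=> rF rK; have := Rec_comp (n := n) (G := fun i e => scons (K e) e i) rF.
have rG i : Rec n (fun e => scons (K e) e i) by case: i => [//|i]; apply: Rec_var.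
move=> /(_ rG); apply: Rec_ext => v; congr F; apply/funext => i.
by case: ltnP => // le_ni; case: i le_ni => //= i le_ni; rewrite nth_default ?size_tuple.
Qed.

Lemma Rec_rec n (f g : nat -> (nat -> nat) -> nat) K :
  Rec n (f 0) -> (forall k e, f k.+1 e = g k (scons (f k e) e)) ->
  Rec n.+2 (fun e => g (e 0) (fun i => e i.+1)) -> Rec n K ->
  Rec n (fun e => f (K e) e).
Proof.
move=> rf0 fS rg rK.
suff rf : Rec n.+1 (fun e => f (e 0) (fun i => e i.+1)).
  have := Rec_scons rf rK; apply: Rec_ext => v /=; congr (f _ _).
apply: (rec_prec (g := fun v => f 0 (nth 0 v)) rf0 rg) => [v|k v].
  by rewrite nth_scons.
by rewrite !nth_scons /= fS.
Qed.

(** In a primitive recursion the step sees the value at the predecessor as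
    variable 1, which F is not to see. *)
Lemma Rec_skip n F : Rec n.+1 F -> Rec n.+2 (fun e => F (scons (e 0) (fun i => e i.+2))).
Proof.
move=> rF; have := Rec_comp (n := n.+2)
  (G := fun i e => scons (e 0) (fun i => e i.+2) i) rF.
have rG i : Rec n.+2 (fun e => scons (e 0) (fun i => e i.+2) i).
  by case: i => [|i]; apply: Rec_var.
move=> /(_ rG); apply: Rec_ext => v; congr F; apply/funext => i.
by case: ltnP => // le_ni; case: i le_ni => //= i le_ni; rewrite nth_default ?size_tuple.
Qed.

Lemma Rec_app1 n h F : Rec 1 (fun e => h (e 0)) -> Rec n F -> Rec n (fun e => h (F e)).
Proof. by move=> rh rF; apply: (Rec_comp rh (fun=> rF)). Qed.

Lemma Rec_app2 n h F G : Rec 2 (fun e => h (e 0) (e 1)) ->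
  Rec n F -> Rec n G -> Rec n (fun e => h (F e) (G e)).
Proof.
move=> rh rF rG; apply: (Rec_comp rh (G := nth F [:: F; G])).
by move=> [|[|i]] //=; rewrite nth_nil.
Qed.

Lemma Rec_iter n (h : nat -> nat) K F : Rec 1 (fun e => h (e 0)) ->
  Rec n K -> Rec n F -> Rec n (fun e => iter (K e) h (F e)).
Proof.
move=> rh rK rF; apply: (Rec_rec (f := fun k e => iter k h (F e))
  (g := fun _ e => h (e 0))) => //.
by apply: Rec_app1 rh _; apply: Rec_var.
Qed.

Lemma Rec_pred n F : Rec n F -> Rec n (fun e => (F e).-1).
Proof.
apply: Rec_app1; apply: (Rec_rec (f := fun k _ => k.-1) (g := fun k _ => k)) => //;
  by [apply: Rec_zero|apply: Rec_var].
Qed.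

Lemma Rec_add n F G : Rec n F -> Rec n G -> Rec n (fun e => F e + G e).
Proof.
move=> rF rG; have := Rec_iter (h := S) _ rF rG.
have r : Rec 1 (fun e => (e 0).+1) by apply: Rec_succ; apply: Rec_var.
by move=> /(_ r); apply: Rec_ext => v; rewrite iter_succn addnC.
Qed.

Lemma Rec_sub n F G : Rec n F -> Rec n G -> Rec n (fun e => F e - G e).
Proof.
move=> rF rG; have := Rec_iter (h := predn) _ rG rF.
have r : Rec 1 (fun e => (e 0).-1) by apply: Rec_pred; apply: Rec_var.
by move=> /(_ r); apply: Rec_ext => v; rewrite iter_predn.
Qed.

Lemma Rec_mul n F G : Rec n F -> Rec n G -> Rec n (fun e => F e * G e).
Proof.
apply: Rec_app2; apply: (Rec_rec (f := fun k e => k * e 1)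
  (g := fun _ e => e 2 + e 0)) => //; try exact: Rec_zero.
- by apply: Rec_add; apply: Rec_var.
- exact: Rec_var.
Qed.

Lemma Rec_exp n F G : Rec n F -> Rec n G -> Rec n (fun e => F e ^ G e).
Proof.
apply: Rec_app2; apply: (Rec_rec (f := fun k e => e 0 ^ k)
  (g := fun _ e => e 1 * e 0)).
- exact: Rec_const.
- by move=> k e; rewrite expnS.
- by apply: Rec_mul; apply: Rec_var.
- exact: Rec_var.
Qed.

Lemma Rec_fact n F : Rec n F -> Rec n (fun e => (F e)`!).
Proof.
apply: Rec_app1; apply: (Rec_rec (f := fun k _ => k`!) (g := fun k e => k.+1 * e 0)).
- exact: Rec_const.
- by move=> k e; rewrite factS.
- by apply: Rec_mul; [apply: Rec_succ|]; apply: Rec_var.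
- exact: Rec_var.
Qed.

Lemma Rec_half n F : Rec n F -> Rec n (fun e => (F e)./2).
Proof.
apply: Rec_app1; apply: (Rec_rec (f := fun k _ => k./2) (g := fun k e => k - e 0)).
- exact: Rec_const.
- by move=> k e /=; lia.
- by apply: Rec_sub; apply: Rec_var.
- exact: Rec_var.
Qed.

(** Recursiveness of a Boolean condition is that of its characteristic function. *)
Notation RecB n P := (Rec n (fun e => nat_of_bool (P e))).

Lemma Rec_leq n F G : Rec n F -> Rec n G -> RecB n (fun e => F e <= G e).
Proof.
move=> rF rG; have := Rec_sub (Rec_const n 1) (Rec_sub rF rG).
by apply: Rec_ext => v; rewrite /leq; case: (F _ - G _).
Qed.

Lemma Rec_ltn n F G : Rec n F -> Rec n G -> RecB n (fun e => F e < G e).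
Proof. by move=> rF rG; apply: Rec_leq => //; apply: Rec_succ. Qed.

Lemma Rec_and n P Q : RecB n P -> RecB n Q -> RecB n (fun e => P e && Q e).
Proof.
by move=> rP rQ; apply: Rec_ext (Rec_mul rP rQ) => v; rewrite mulnb.
Qed.

Lemma Rec_not n P : RecB n P -> RecB n (fun e => ~~ P e).
Proof.
move=> rP; apply: Rec_ext (Rec_sub (Rec_const n 1) rP) => v.
by case: (P _).
Qed.

Lemma Rec_or n P Q : RecB n P -> RecB n Q -> RecB n (fun e => P e || Q e).
Proof.
move=> rP rQ; apply: Rec_ext (Rec_not (Rec_and (Rec_not rP) (Rec_not rQ))) => v.
by rewrite negb_and !negbK.
Qed.

Lemma Rec_imp n P Q : RecB n P -> RecB n Q -> RecB n (fun e => P e ==> Q e).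
Proof.
move=> rP rQ; apply: Rec_ext (Rec_or (Rec_not rP) rQ) => v.
by rewrite implybE.
Qed.

Lemma Rec_eq n F G : Rec n F -> Rec n G -> RecB n (fun e => F e == G e).
Proof.
move=> rF rG; apply: Rec_ext (Rec_and (Rec_leq rF rG) (Rec_leq rG rF)) => v.
by rewrite -eqn_leq.
Qed.

Lemma Rec_eqb n P Q : RecB n P -> RecB n Q -> RecB n (fun e => P e == Q e).
Proof.
move=> rP rQ; apply: Rec_ext (Rec_eq rP rQ) => v.
by case: (P _) (Q _) => [] [].
Qed.

Lemma Rec_if n P F G : RecB n P -> Rec n F -> Rec n G ->
  Rec n (fun e => if P e then F e else G e).
Proof.
move=> rP rF rG.
apply: Rec_ext (Rec_add (Rec_mul rP rF) (Rec_mul (Rec_not rP) rG)) => v.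
by case: (P _); rewrite ?mul0n ?mul1n ?addn0.
Qed.

Lemma Rec_ifb n P Q S : RecB n P -> RecB n Q -> RecB n S ->
  RecB n (fun e => if P e then Q e else S e).
Proof.
move=> rP rQ rS; apply: Rec_ext (Rec_if rP rQ rS) => v.
by case: (P _).
Qed.

Lemma Rec_odd n F : Rec n F -> RecB n (fun e => odd (F e)).
Proof.
apply: (Rec_app1 (h := fun k => odd k)).
apply: (Rec_rec (f := fun k _ => odd k) (g := fun k e => 1 - e 0)).
- exact: Rec_const.
- by move=> k e /=; case: (odd k).
- by apply: Rec_sub; [apply: Rec_const|apply: Rec_var].
- exact: Rec_var.
Qed.

Fixpoint ball N (p : nat -> bool) : bool :=
  if N is k.+1 then p k && ball k p else true.

Definition bex N p := ~~ ball N (fun k => ~~ p k).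

Fixpoint bfind N (p : nat -> bool) : nat :=
  if N is k.+1 then (if p k then k else bfind k p) else 0.

Lemma ballP N (p : nat -> bool) : reflect (forall k, k < N -> p k) (ball N p).
Proof.
elim: N => [|N IHN] /=; first by constructor.
apply: (iffP andP) => [[pN /IHN h] k|h].
  by rewrite ltnS leq_eqVlt => /orP[/eqP->|/h].
by split; [exact: h|apply/IHN => k lt_kN; apply: h; apply: ltnW].
Qed.

Lemma bexP N (p : nat -> bool) : reflect (exists2 k, k < N & p k) (bex N p).
Proof.
apply: (iffP idP) => [/ballP h|[k lt_kN pk]].
  apply: contrapT => nex; apply: h => k lt_kN; apply/negP => pk.
  by apply: nex; exists k.
by apply/ballP => /(_ _ lt_kN); rewrite pk.
Qed.

Lemma bfindP N (p : nat -> bool) k : k < N -> p k -> (forall j, p j -> j = k) ->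
  bfind N p = k.
Proof.
move=> lt_kN pk uk; elim: N lt_kN => //= N IHN; rewrite ltnS leq_eqVlt.
by case: ifP => [/uk//|pN]; case/orP => [/eqP eN|/IHN//]; rewrite -eN pk in pN.
Qed.

Lemma bfind_cases N (p : nat -> bool) : bfind N p = 0 \/ p (bfind N p).
Proof. by elim: N => [|N IHN] /=; [left|case: ifP => pN; [right|]]. Qed.

Lemma bfind_le N p : bfind N p <= N.-1.
Proof. by elim: N => //= N IHN; case: ifP => // _; apply: leq_trans IHN (leq_pred N). Qed.

Lemma Rec_ball n (P : nat -> (nat -> nat) -> bool) K : Rec n K ->
  RecB n.+1 (fun e => P (e 0) (fun i => e i.+1)) ->
  RecB n (fun e => ball (K e) (fun k => P k e)).
Proof.
move=> rK rP; apply: (Rec_rec (f := fun k e => ball k (fun k => P k e))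
  (g := fun k e => P k (fun i => e i.+1) * e 0)) => //.
- exact: Rec_const.
- by move=> k e /=; rewrite mulnb.
- by apply: Rec_mul; [exact: (Rec_skip rP)|apply: Rec_var].
Qed.

Lemma Rec_bex n (P : nat -> (nat -> nat) -> bool) K : Rec n K ->
  RecB n.+1 (fun e => P (e 0) (fun i => e i.+1)) ->
  RecB n (fun e => bex (K e) (fun k => P k e)).
Proof.
move=> rK rP; apply: Rec_not; apply: (Rec_ball (P := fun k e => ~~ P k e)) => //.
exact: Rec_not.
Qed.

Lemma Rec_bfind n (P : nat -> (nat -> nat) -> bool) K : Rec n K ->
  RecB n.+1 (fun e => P (e 0) (fun i => e i.+1)) ->
  Rec n (fun e => bfind (K e) (fun k => P k e)).
Proof.
move=> rK rP; apply: (Rec_rec (f := fun k e => bfind k (fun k => P k e))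
  (g := fun k e => if P k (fun i => e i.+1) then k else e 0)) => //.
- exact: Rec_const.
- by apply: Rec_if; [exact: (Rec_skip rP)|apply: Rec_var|apply: Rec_var].
Qed.

#[local] Arguments ball : simpl never.
#[local] Arguments bex : simpl never.

(** Minimization is confined to regular functions, so the search has to succeed for
    every c. *)
Lemma Rec_mu (H : nat -> nat -> bool) (f : nat -> nat) :
  RecB 2 (fun e => H (e 0) (e 1)) -> (forall c, H (f c) c) ->
  (forall c k, H k c -> f c <= k) -> Rec 1 (fun e => f (e 0)).
Proof.
move=> rH Hf minf; apply: (rec_mu (Rec_not rH)) => [v|v k].
  by rewrite nth_scons /= Hf.
by rewrite nth_scons /= ltnNge; case: (H k _) (minf (nth 0 v 0) k) => // ->.
Qed.

(** * Pairs, finite sets and signed integers as numbers *)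

Lemma leq_cpair m n : m + n <= cpair m n.
Proof. by rewrite /cpair; nia. Qed.

Definition cfst z := bfind z.+1 (fun a => bex z.+1 (fun b => cpair a b == z)).
Definition csnd z := bfind z.+1 (fun b => bex z.+1 (fun a => cpair a b == z)).

#[local] Arguments cpair : simpl never.
#[local] Arguments cfst : simpl never.
#[local] Arguments csnd : simpl never.

Lemma cfstK a b : cfst (cpair a b) = a.
Proof.
have := leq_cpair a b => h; apply: bfindP => [|| a' /bexP[b' _ /eqP /cpair_inj[]]//]; first lia.
by apply/bexP; exists b => //; lia.
Qed.

Lemma csndK a b : csnd (cpair a b) = b.
Proof.
have := leq_cpair a b => h; apply: bfindP => [|| b' /bexP[a' _ /eqP /cpair_inj[]]//]; first lia.
by apply/bexP; exists a => //; lia.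
Qed.

Lemma cfst_le z : cfst z <= z. Proof. exact: bfind_le. Qed.
Lemma csnd_le z : csnd z <= z. Proof. exact: bfind_le. Qed.

Lemma csnd_lt z : 0 < cfst z -> csnd z < z.
Proof.
move=> z0; case: (bfind_cases z.+1 (fun a => bex z.+1 (fun b => cpair a b == z))).
  by rewrite -/(cfst z) => e; rewrite e in z0.
rewrite -/(cfst z) => /bexP[b _ /eqP ez].
have -> : csnd z = b by rewrite -ez csndK.
by have := leq_cpair (cfst z) b; lia.
Qed.

(** A finite set of numbers is coded by the number whose binary digits 1 are at the
    members; all members are then below the code, which bounds quantifiers over
    them. *)
Definition bit p x := odd (iter x half p).

Lemma bitS p x : bit p x.+1 = bit p./2 x.
Proof. by rewrite /bit iterSr. Qed.

Lemma bit_lt p x : bit p x -> x < p.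
Proof.
elim: x p => [|x IHx] p; first by case: p.
by rewrite bitS => /IHx; lia.
Qed.

Lemma leq_bit p q : (forall x, bit p x -> bit q x) -> p <= q.
Proof.
elim/ltn_ind: p q => -[|p] // IHp q pq.
have le_half : p.+1./2 <= q./2.
  by apply: IHp => [|x]; [lia|rewrite -!bitS; apply: pq].
have := pq 0; rewrite /bit /=; lia.
Qed.

Lemma bit_exists (P : nat -> bool) N : exists p, forall x, bit p x = (x < N) && P x.
Proof.
elim: N P => [|N IHN] P; first by exists 0 => x; rewrite ltn0 /=; elim: x => // x; rewrite bitS.
have [p hp] := IHN (fun x => P x.+1); exists (P 0 + p.*2) => -[|x].
  by rewrite /bit /= oddD odd_double addbF oddb.
by rewrite bitS half_bit_double hp.
Qed.

Definition mk_elt s a b := cpair s (cpair a b).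

(** The pair (a, b) stands for the integer a - b. *)
Definition elt (v : nat) : signed int :=
  if cfst v == 0 then None
  else Some (cfst v == 1, ((cfst (csnd v))%:Z - (csnd (csnd v))%:Z)%R).

Lemma elt_mk s a b : elt (mk_elt s a b) =
  if s == 0 then None else Some (s == 1, (a%:Z - b%:Z)%R).
Proof. by rewrite /elt /mk_elt !(cfstK, csndK). Qed.

Definition elt_mul u v := mk_elt
  (if (cfst u == 0) || (cfst v == 0) then 0
   else if (cfst u == 1) == (cfst v == 1) then 1 else 2)
  (cfst (csnd u) + cfst (csnd v)) (csnd (csnd u) + csnd (csnd v)).
Definition elt_inv u := mk_elt (cfst u) (csnd (csnd u)) (cfst (csnd u)).
Definition elt_eqb u v := if cfst u == 0 then cfst v == 0 else
  [&& cfst v != 0, (cfst u == 1) == (cfst v == 1) &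
      cfst (csnd u) + csnd (csnd v) == cfst (csnd v) + csnd (csnd u)].

Lemma elt_mulE u v : elt (elt_mul u v) = mulI (elt u) (elt v).
Proof.
rewrite elt_mk /elt; case: (cfst u == 0) => //=; case: (cfst v == 0) => //=.
by case: (cfst u == 1); case: (cfst v == 1) => /=; congr (Some (_, _)); lia.
Qed.

Lemma elt_invE u : elt (elt_inv u) = invI (elt u).
Proof. by rewrite elt_mk /elt; case: (cfst u == 0) => //=; congr (Some (_, _)); lia. Qed.

Lemma elt_eqbP u v : elt_eqb u v <-> elt u = elt v.
Proof.
rewrite /elt_eqb /elt; case: (cfst u == 0); case: (cfst v == 0) => //=.
split=> [/andP[/eqP-> /eqP h]|[-> h]]; first by congr (Some (_, _)); lia.
by rewrite eqxx; apply/eqP; lia.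
Qed.

Lemma elt_posP u : cfst u == 1 <-> posI (elt u).
Proof. by rewrite /elt; case: eqP => [->//|_]; case: (cfst u == 0). Qed.

(** Environments are coded as lists, of which all entries beyond the end are 0,
    that is, zero. *)
Definition lookup env i := cfst (iter i csnd env).
Definition env_fun env (i : nat) : signed int := elt (lookup env i).

Lemma env_fun_cons v env : env_fun (cpair v env) = scons (elt v) (env_fun env).
Proof.
apply/funext => -[|i]; rewrite /env_fun /lookup /= ?cfstK //.
by rewrite -[csnd (iter _ _ _)]/(iter i.+1 csnd _) iterSr csndK.
Qed.

Lemma env_fun_nil : env_fun 0 = fun=> None.
Proof.
apply/funext => i; rewrite /env_fun /lookup.
have -> : iter i csnd 0 = 0.
  by elim: i => // i /= ->; apply/eqP; rewrite -leqn0 csnd_le.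
by have := cfst_le 0; rewrite leqn0 /elt => /eqP h; rewrite /elt h.
Qed.

(** [rec] proves a defined function recursive by following the syntax of its body;
    [rec_fun] is extended with every function that has been dealt with. *)
Ltac rec_fun := fail.

Ltac rec_step := lazymatch goal with
  | |- Rec _ (fun e => e _) => exact: Rec_var
  | |- Rec _ (fun _ => ?c) => exact: Rec_const
  | |- Rec _ (fun e => nat_of_bool (if _ then _ else _)) => apply: Rec_ifb
  | |- Rec _ (fun e => nat_of_bool (_ && _)) => apply: Rec_and
  | |- Rec _ (fun e => nat_of_bool (_ || _)) => apply: Rec_or
  | |- Rec _ (fun e => nat_of_bool (_ ==> _)) => apply: Rec_imp
  | |- Rec _ (fun e => nat_of_bool (~~ _)) => apply: Rec_not
  | |- Rec _ (fun e => nat_of_bool (@eq_op _ _ _)) => first [apply: Rec_eq|apply: Rec_eqb]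
  | |- Rec _ (fun e => nat_of_bool (_ < _)) => apply: Rec_ltn
  | |- Rec _ (fun e => nat_of_bool (_ <= _)) => apply: Rec_leq
  | |- Rec _ (fun e => nat_of_bool (odd _)) => apply: Rec_odd
  | |- Rec _ (fun e => nat_of_bool (bex _ _)) => apply Rec_bex
  | |- Rec _ (fun e => nat_of_bool (ball _ _)) => apply Rec_ball
  | |- Rec _ (fun e => bfind _ _) => apply Rec_bfind
  | |- Rec _ (fun e => if _ then _ else _) => apply: Rec_if
  | |- Rec _ (fun e => _.+1) => apply: Rec_succ
  | |- Rec _ (fun e => _.-1) => apply: Rec_pred
  | |- Rec _ (fun e => _ + _) => apply: Rec_add
  | |- Rec _ (fun e => _ - _) => apply: Rec_sub
  | |- Rec _ (fun e => _ * _) => apply: Rec_mul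
  | |- Rec _ (fun e => _ ^ _) => apply: Rec_exp
  | |- Rec _ (fun e => _ `!) => apply: Rec_fact
  | |- Rec _ (fun e => half _) => apply: Rec_half
  | _ => rec_fun
  end.
Ltac rec := repeat rec_step.

Lemma Rec_cpair n F G : Rec n F -> Rec n G -> Rec n (fun e => cpair (F e) (G e)).
Proof. by apply: Rec_app2; rewrite /cpair; rec. Qed.

Ltac rec_fun ::= apply: Rec_cpair.

Lemma Rec_cfst n F : Rec n F -> Rec n (fun e => cfst (F e)).
Proof. by apply: Rec_app1; rewrite /cfst; rec. Qed.

Lemma Rec_csnd n F : Rec n F -> Rec n (fun e => csnd (F e)).
Proof. by apply: Rec_app1; rewrite /csnd; rec. Qed.

Ltac rec_fun ::= lazymatch goal with
  | |- Rec _ (fun e => cpair _ _) => apply: Rec_cpair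
  | |- Rec _ (fun e => cfst _) => apply: Rec_cfst
  | |- Rec _ (fun e => csnd _) => apply: Rec_csnd
  end.

Lemma Rec_bit n F G : Rec n F -> Rec n G -> RecB n (fun e => bit (F e) (G e)).
Proof.
apply: (Rec_app2 (h := fun p x => bit p x)); rewrite /bit.
by apply: Rec_odd; apply: (Rec_iter (h := half)); rec.
Qed.

Lemma Rec_lookup n F G : Rec n F -> Rec n G -> Rec n (fun e => lookup (F e) (G e)).
Proof.
by apply: Rec_app2; rewrite /lookup; apply: Rec_cfst; apply: (Rec_iter (h := csnd)); rec.
Qed.

Lemma Rec_elt_mul n F G : Rec n F -> Rec n G -> Rec n (fun e => elt_mul (F e) (G e)).
Proof. by apply: Rec_app2; rewrite /elt_mul /mk_elt; rec. Qed.

Lemma Rec_elt_eqb n F G : Rec n F -> Rec n G -> RecB n (fun e => elt_eqb (F e) (G e)).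
Proof. by apply: (Rec_app2 (h := fun u v => elt_eqb u v)); rewrite /elt_eqb; rec. Qed.

Lemma Rec_modulus n F : Rec n F -> Rec n (fun e => modulus (F e)).
Proof. by apply: Rec_app1; rewrite /modulus /cbound; rec. Qed.

Ltac rec_fun ::= lazymatch goal with
  | |- Rec _ (fun e => cpair _ _) => apply: Rec_cpair
  | |- Rec _ (fun e => cfst _) => apply: Rec_cfst
  | |- Rec _ (fun e => csnd _) => apply: Rec_csnd
  | |- Rec _ (fun e => nat_of_bool (bit _ _)) => apply: Rec_bit
  | |- Rec _ (fun e => lookup _ _) => apply: Rec_lookup
  | |- Rec _ (fun e => elt_mul _ _) => apply: Rec_elt_mul
  | |- Rec _ (fun e => nat_of_bool (elt_eqb _ _)) => apply: Rec_elt_eqb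
  | |- Rec _ (fun e => modulus _) => apply: Rec_modulus
  end.

(** * Certificates *)

(** The claim that the formula (or, with tag 0, the term) of code c has value v in
    the environment env; for formulas the tag is one more than the number of
    rounds left in the game. *)
Definition claim tag c env v := cpair tag (cpair c (cpair env v)).

(** The j-th element of sign s over which a quantifier ranges; the exponents are
    the integers (j - G) * F ^ d with |j - G| <= G, for G as in [range_half]. *)
Definition range_half c0 d := modulus c0 ^ (2 * c0 - 2 * d).
Definition range_elt c0 d s j :=
  mk_elt s (j * modulus c0 ^ d) (range_half c0 d * modulus c0 ^ d).

Definition check_term p k r env v := [||
  (k == 0) && (v == lookup env r), (k == 1) && (v == mk_elt 0 0 0),
  (k == 2) && (v == mk_elt 1 0 0), (k == 3) && (v == mk_elt 2 0 0),
  (k == 4) && bex p (fun v1 => bex p (fun v2 =>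
    [&& bit p (claim 0 (cfst r) env v1), bit p (claim 0 (csnd r) env v2) & v == elt_mul v1 v2])),
  (k == 5) && bex p (fun v1 => bit p (claim 0 r env v1) && (v == elt_inv v1)) |
  (5 < k) && (v == 0)].

Definition check_formula c0 p tag k r env v := [||
  (k == 0) && (v == 0),
  (k == 1) && bex p (fun v1 => bex p (fun v2 =>
    [&& bit p (claim 0 (cfst r) env v1), bit p (claim 0 (csnd r) env v2) & v == elt_eqb v1 v2])),
  (k == 2) && bex p (fun v1 => bit p (claim 0 r env v1) && (v == (cfst v1 == 1))),
  (k == 3) && bex p (fun b1 => bex p (fun b2 =>
    [&& bit p (claim tag (cfst r) env b1), bit p (claim tag (csnd r) env b2)
      & v == ((b1 == 1) ==> (b2 == 1))])),
  [&& k == 4, v == 1 & ball 3 (fun s => ball (2 * range_half c0 tag.-2).+1 (fun j =>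
    bit p (claim tag.-2.+1 r (cpair (range_elt c0 tag.-2 s j) env) 1)))],
  [&& k == 4, v == 0 & bex 3 (fun s => bex (2 * range_half c0 tag.-2).+1 (fun j =>
    bit p (claim tag.-2.+1 r (cpair (range_elt c0 tag.-2 s j) env) 0)))] |
  (4 < k) && (v == 0)].

(** Validity of a single step of the evaluation; subterms and subformulas have their
    values claimed in p. *)
Definition check c0 p x :=
  let tag := cfst x in let c := cfst (csnd x) in
  let env := cfst (csnd (csnd x)) in let v := csnd (csnd (csnd x)) in
  if tag == 0 then check_term p (cfst c) (csnd c) env v
  else check_formula c0 p tag (cfst c) (csnd c) env v.

Definition certificate c0 p : bool := ball p (fun x => bit p x ==> check c0 p x).

Lemma Rec_certificate n F G : Rec n F -> Rec n G -> RecB n (fun e => certificate (F e) (G e)).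
Proof.
apply: (Rec_app2 (h := fun c0 p => certificate c0 p)).
rewrite /certificate /check /check_term /check_formula /range_elt /range_half /mk_elt /claim /elt_inv /mk_elt.
by rec.
Qed.

Lemma certificateP c0 p :
  reflect (forall x, bit p x -> check c0 p x) (certificate c0 p).
Proof.
apply: (iffP (ballP _ _)) => h x; last by move=> _; apply/implyP/h.
by move=> px; have := h x (bit_lt px); rewrite px.
Qed.

Lemma check_claim c0 p tag c env v : check c0 p (claim tag c env v) =
  if tag == 0 then check_term p (cfst c) (csnd c) env v
  else check_formula c0 p tag (cfst c) (csnd c) env v.
Proof. by rewrite /check /claim !(cfstK, csndK). Qed.

Lemma claim_lt p tag c env v : bit p (claim tag c env v) -> v < p.
Proof.
move=> /bit_lt; rewrite /claim.
have := leq_cpair env v; have := leq_cpair c (cpair env v).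
have := leq_cpair tag (cpair c (cpair env v)); lia.
Qed.

(** * Soundness of certificates *)

Lemma certificate_term c0 p t env v : certificate c0 p ->
  bit p (claim 0 (tcode t) env v) -> elt v = teval (M := signed int) (env_fun env) t.
Proof.
move=> /certificateP cp; elim: t v => [i||||s IHs t IHt|t IHt] v /= hv;
  have := cp _ hv; rewrite check_claim /= /check_term !(cfstK, csndK) /= ?orbF.
- by move=> /eqP ->.
- by move=> /eqP ->; rewrite elt_mk.
- by move=> /eqP ->; rewrite elt_mk.
- by move=> /eqP ->; rewrite elt_mk.
- move=> /bexP[v1 _ /bexP[v2 _ /and3P[/IHs e1 /IHt e2 /eqP ->]]].
  by rewrite elt_mulE e1 e2.
- by move=> /bexP[v1 _ /andP[/IHt e1 /eqP ->]]; rewrite elt_invE e1.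
Qed.

Lemma range_elt_in c0 d s j : d <= c0 -> j < (2 * range_half c0 d).+1 ->
  in_range c0 d (elt (range_elt c0 d s j)).
Proof.
move=> hd hj; rewrite /range_elt elt_mk; case: eqP => _; first exact: in_range_zero.
rewrite !PoszM -mulrBl; split; rewrite /= abszM ?dvdn_mull //.
rewrite [in leqRHS](_ : 2 * c0 - d = 2 * c0 - 2 * d + d); last lia.
by rewrite expnD -/(range_half c0 d) leq_mul2r; apply/orP; right; lia.
Qed.

Lemma range_elt_surj c0 d x : d <= c0 -> in_range c0 d x ->
  exists s j, [/\ s < 3, j < (2 * range_half c0 d).+1 & elt (range_elt c0 d s j) = x].
Proof.
move=> hd; case: x => [[b w]|] [/= dv le]; last by exists 0, 0; rewrite /range_elt elt_mk.
have F0 : 0 < modulus c0 ^ d by rewrite expn_gt0 modulus_gt0.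
have /dvdzP[q wq] : ((modulus c0 ^ d)%:Z %| w)%Z by rewrite dvdzE.
have hq : `|q|%N <= range_half c0 d.
  rewrite -(leq_pmul2r F0) -expnD (_ : _ + d = 2 * c0 - d); last lia.
  by apply: leq_trans le; rewrite wq abszM.
exists (if b then 1 else 2), (`|(q + (range_half c0 d)%:Z)%R|%N); split.
- by case: b.
- by lia.
- rewrite /range_elt elt_mk; have -> : ((if b then 1 else 2) == 0) = false by case: b.
  rewrite (_ : ((if b then 1 else 2) == 1) = b); last by case: b.
  congr (Some (_, _)); rewrite wq !PoszM -mulrBl; congr (_ * _)%R; lia.
Qed.

Lemma certificate_formula c0 p A d env v : certificate c0 p -> d <= c0 ->
  formula_size A <= d ->
  bit p (claim d.+1 (code A) env v) ->
  (v = 1 /\ bsat c0 d (env_fun env) A) \/ (v = 0 /\ ~ bsat c0 d (env_fun env) A).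
Proof.
move=> cp; have ct t := certificate_term (t := t) cp.
elim: A d env v => [|s t|t|A IHA B IHB|A IHA] d env v hd hA /= hv;
  have := certificateP _ _ cp _ hv; rewrite check_claim /= /check_formula !(cfstK, csndK) /= ?orbF.
- by move=> /eqP ->; right; split.
- move=> /bexP[v1 _ /bexP[v2 _ /and3P[/ct <- /ct <- /eqP ->]]].
  by case: (boolP (elt_eqb v1 v2)) => [/elt_eqbP h|/negP h]; [left|right; split=> // /elt_eqbP].
- move=> /bexP[v1 _ /andP[/ct <- /eqP ->]].
  by have := elt_posP v1; case: eqP => _ [h1 h2]; [left|right]; split=> //; [exact: h1|move/h2].
- rewrite /= in hA.
  have hA' : formula_size A <= d by lia.
  have hB' : formula_size B <= d by lia.
  move=> /bexP[b1 _ /bexP[b2 _ /and3P[/(IHA _ _ _ hd hA') h1 /(IHB _ _ _ hd hB') h2 /eqP ->]]].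
  by case: h1 h2 => [[-> hA1]|[-> hA1]] [[-> hB1]|[-> hB1]] /=;
    [left|right|left|left]; split => // h; apply: hB1; apply: h.
- case: d hd hA hv => // d hd hA hv.
  have hd' : d <= c0 by apply: ltnW.
  move=> /orP[/andP[/eqP-> /ballP h]|/andP[/eqP-> /bexP[s s3 /bexP[j hj]]]].
    left; split=> // y ry.
    have [s [j [s3 hj <-]]] := range_elt_surj hd' ry.
    have /ballP/(_ j hj)/= := h s s3.
    by move=> /(IHA _ _ _ hd' hA); rewrite env_fun_cons => -[[]//|[]].
  move=> /(IHA _ _ _ hd' hA); rewrite env_fun_cons => -[[//]|[_ hA0]].
  by right; split=> // h; apply: hA0; apply: h; apply: range_elt_in.
Qed.

(** * Existence of certificates *)

Lemma bex_mono N N' (P Q : nat -> bool) : N <= N' -> (forall k, P k -> Q k) ->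
  bex N P -> bex N' Q.
Proof.
move=> le_NN' PQ /bexP[k lt_kN /PQ Qk]; apply/bexP; exists k => //.
exact: leq_trans le_NN'.
Qed.

Lemma ball_mono N (P Q : nat -> bool) : (forall k, P k -> Q k) -> ball N P -> ball N Q.
Proof. by move=> PQ /ballP h; apply/ballP => k /h /PQ. Qed.

(** More claims support more claims: the bounds of the searches grow with the set
    by [leq_bit]. *)
Lemma check_mono c0 p q x : (forall x, bit p x -> bit q x) ->
  check c0 p x -> check c0 q x.
Proof.
move=> pq; have le_pq := leq_bit pq.
have orM (a a' b b' : bool) : (a -> a') -> (b -> b') -> a || b -> a' || b'.
  by move=> ha hb /orP[/ha->|/hb->]; rewrite ?orbT.
have andM (a a' b b' : bool) : (a -> a') -> (b -> b') -> a && b -> a' && b'.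
  by move=> ha hb /andP[/ha-> /hb->].
rewrite /check /check_term /check_formula; case: ifP => _.
  do 6?[apply: (orM) => //]; apply: (andM) => //; apply: bex_mono => // v1.
    apply: bex_mono => // v2; apply: (andM); first exact: pq.
    by apply: (andM) => //; apply: (pq).
  by apply: (andM) => //; apply: (pq).
do 6?[apply: (orM) => //]; apply: (andM) => //.
- apply: bex_mono => // v1; apply: bex_mono => // v2; apply: (andM); first exact: pq.
  by apply: (andM) => //; apply: (pq).
- by apply: bex_mono => // v1; apply: (andM) => //; apply: (pq).
- apply: bex_mono => // v1; apply: bex_mono => // v2; apply: (andM); first exact: pq.
  by apply: (andM) => //; apply: (pq).
- apply: (andM) => //; apply: ball_mono => s; apply: ball_mono => j; exact: pq.
- apply: (andM) => //; apply: bex_mono => // s; apply: bex_mono => // j; exact: pq.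
Qed.

Lemma certificate_union c0 p q : certificate c0 p -> certificate c0 q ->
  exists r, [/\ certificate c0 r, forall x, bit p x -> bit r x & forall x, bit q x -> bit r x].
Proof.
move=> /certificateP cp /certificateP cq.
have [r br] := bit_exists (fun x => bit p x || bit q x) (maxn p q).
have pr x : bit p x -> bit r x.
  by move=> px; rewrite br px andbT leq_max (bit_lt px).
have qr x : bit q x -> bit r x.
  by move=> qx; rewrite br qx orbT andbT leq_max (bit_lt qx) orbT.
exists r; split=> //; apply/certificateP => x.
by rewrite br => /andP[_ /orP[/cp|/cq]]; apply: check_mono.
Qed.

Lemma certificate_extend c0 p x : certificate c0 p -> check c0 p x ->
  exists2 q, certificate c0 q & bit q x.
Proof.
move=> /certificateP cp hx.
have [q bq] := bit_exists (fun y => bit p y || (y == x)) (maxn p x.+1).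
have pq y : bit p y -> bit q y.
  by move=> py; rewrite bq py andbT leq_max (bit_lt py).
exists q; last by rewrite bq eqxx orbT andbT leq_max leqnn orbT.
apply/certificateP => y; rewrite bq => /andP[_ /orP[/cp|/eqP->]]; first exact: check_mono.
exact: check_mono hx.
Qed.

Lemma certificate_all c0 (X : eqType) (s : seq X) (Q : X -> nat -> Prop) :
  (forall x p q, (forall y, bit p y -> bit q y) -> Q x p -> Q x q) ->
  (forall x, exists2 p, certificate c0 p & Q x p) ->
  exists2 p, certificate c0 p & forall x, x \in s -> Q x p.
Proof.
move=> mQ hQ; elim: s => [|x s [p cp hp]].
  by exists 0.
have [q cq hq] := hQ x; have [r [cr pr qr]] := certificate_union cp cq.
exists r => // y; rewrite in_cons => /orP[/eqP->|/hp]; [exact: mQ qr hq|exact: mQ].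
Qed.

(** Codes that are not codes of formulas also get a value: the search for a
    certificate has to succeed on every input. *)
Lemma certificate_exists c0 c tag env : exists2 p, certificate c0 p &
  exists2 v, (0 < tag -> v <= 1) & bit p (claim tag c env v).
Proof.
elim/ltn_ind: c tag env => c IHc tag env.
pose k := cfst c; pose r := csnd c.
suff [p [v [cp hv hk]]] : exists p v, [/\ certificate c0 p, 0 < tag -> v <= 1 &
    if tag == 0 then check_term p k r env v else check_formula c0 p tag k r env v].
  have := certificate_extend (x := claim tag c env v) cp.
  by rewrite check_claim => /(_ hk) [q cq bq]; exists q => //; exists v.
have c00 : certificate c0 0 by [].
have [k0|k0] := posnP k.
  exists 0, (if tag == 0 then lookup env r else 0); rewrite k0 /check_term /check_formula.
  by split=> //; [case: (tag)|case: (tag == 0); rewrite !eqxx].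
have hr : r < c by apply: csnd_lt.
have h1 : cfst r < c by apply: leq_ltn_trans (cfst_le r) hr.
have h2 : csnd r < c by apply: leq_ltn_trans (csnd_le r) hr.
have two tag' : exists2 p, certificate c0 p & exists v1 v2,
    [/\ 0 < tag' -> v1 <= 1, bit p (claim tag' (cfst r) env v1), v1 < p,
        bit p (claim tag' (csnd r) env v2) & v2 < p].
  have [p cp [v1 hv1 b1]] := IHc _ h1 tag' env.
  have [q cq [v2 _ b2]] := IHc _ h2 tag' env.
  have [u [cu pu qu]] := certificate_union cp cq.
  exists u => //; exists v1, v2; split=> //; [exact: pu|exact: claim_lt (pu _ b1)| |].
    exact: qu.
  exact: claim_lt (qu _ b2).
have one tag' : exists2 p, certificate c0 p & exists2 v1,
    bit p (claim tag' r env v1) & v1 < p.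
  have [p cp [v1 hv1 b1]] := IHc _ hr tag' env.
  by exists p => //; exists v1 => //; apply: claim_lt b1.
clearbody k r; have [_|_] := posnP tag.
  rewrite /check_term; case: k k0 => [|[|[|[|[|[|k]]]]]] k0 /=; first by [].
  - by exists 0, (mk_elt 0 0 0).
  - by exists 0, (mk_elt 1 0 0).
  - by exists 0, (mk_elt 2 0 0).
  - have [p cp [v1 [v2 [_ b1 l1 b2 l2]]]] := two 0.
    exists p, (elt_mul v1 v2); split=> //; rewrite orbF; apply/bexP; exists v1 => //.
    by apply/bexP; exists v2 => //; rewrite b1 b2 /=.
  - have [p cp [v1 b1 l1]] := one 0.
    by exists p, (elt_inv v1); split=> //; rewrite orbF; apply/bexP; exists v1; rewrite ?b1 /=.
  - by exists 0, 0.
rewrite /check_formula; case: k k0 => [|[|[|[|[|k]]]]] k0 /=; first by [].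
- have [p cp [v1 [v2 [_ b1 l1 b2 l2]]]] := two 0.
  exists p, (elt_eqb v1 v2); split=> //; first by case: elt_eqb.
  rewrite orbF; apply/bexP; exists v1 => //.
  by apply/bexP; exists v2 => //; rewrite b1 b2 /=.
- have [p cp [v1 b1 l1]] := one 0.
  exists p, (cfst v1 == 1); split=> //; first by case: eqP.
  by rewrite orbF; apply/bexP; exists v1; rewrite ?b1 /=.
- have [p cp [v1 [v2 [_ b1 l1 b2 l2]]]] := two tag.
  exists p, ((v1 == 1) ==> (v2 == 1)); split=> //; first by case: (_ ==> _).
  rewrite orbF; apply/bexP; exists v1 => //.
  by apply/bexP; exists v2 => //; rewrite b1 b2 /=.
- set d := tag.-2; pose J := iota 0 (2 * range_half c0 d).+1.
  have [||p cp hp] := @certificate_all c0 _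
    [seq cpair (range_elt c0 d s j) env | s <- iota 0 3, j <- J]
    (fun env' p => exists2 v, v <= 1 & bit p (claim d.+1 r env' v)).
  + by move=> env' p q pq [v v1 /pq]; exists v.
  + move=> env'; have [p cp [v hv bv]] := IHc _ hr d.+1 env'.
    by exists p => //; exists v => //; apply: hv.
  have hpsj s j : s < 3 -> j < (2 * range_half c0 d).+1 ->
      exists2 v, v <= 1 & bit p (claim d.+1 r (cpair (range_elt c0 d s j) env) v).
    by move=> s3 hj; apply: hp; apply/allpairsP; exists (s, j); rewrite !mem_iota.
  have [h0|h0] := boolP (bex 3 (fun s => bex (2 * range_half c0 d).+1 (fun j =>
    bit p (claim d.+1 r (cpair (range_elt c0 d s j) env) 0)))).
    by exists p, 0; split=> //; rewrite h0 orbT.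
  exists p, 1; split=> //; apply/orP; left; apply/ballP => s s3; apply/ballP => j hj.
  have [[|[|v]] // _ bv] := hpsj s j s3 hj.
  by case/negP: h0; apply/bexP; exists s => //; apply/bexP; exists j.
- by exists 0, 0.
Qed.

(** * Decidability *)

Lemma term_size_code t : term_size t <= (tcode t).+1.
Proof.
elim: t => //= [s IHs t IHt|t IHt].
  have := leq_cpair (tcode s) (tcode t).
  have := leq_cpair 4 (cpair (tcode s) (tcode t)); lia.
have := leq_cpair 5 (tcode t); lia.
Qed.

Lemma formula_size_code A : formula_size A <= (code A).+1.
Proof.
elim: A => //= [s t|t|A IHA B IHB|A IHA].
- have := leq_cpair (tcode s) (tcode t); have := leq_cpair 1 (cpair (tcode s) (tcode t)).
  have := term_size_code s; have := term_size_code t; lia.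
- have := leq_cpair 2 (tcode t); have := term_size_code t; lia.
- have := leq_cpair (code A) (code B).
  have := leq_cpair 3 (cpair (code A) (code B)); lia.
- have := leq_cpair 4 (code A); lia.
Qed.

(** A sentence of code c has size at most c + 1, which is the number of rounds and
    the bound on the game; the tag is one more, and the empty environment is 0. *)
Definition root c v := claim c.+2 c 0 v.

Definition decides p c : bool :=
  certificate c.+1 p && (bit p (root c 1) || bit p (root c 0)).

Lemma decides_exists c : exists p, decides p c.
Proof.
have [p cp [[|[|v]] hv bv]] := certificate_exists c.+1 c c.+2 0.
- by exists p; rewrite /decides cp bv orbT.
- by exists p; rewrite /decides cp bv.
- by have := hv isT.
Qed.

(** The least certificate settles the sentence one way or the other; by soundness it
    contains the claim of truth exactly if the sentence is true. *)
Definition decision c : nat := bit (ex_minn (decides_exists c)) (root c 1).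

Lemma Rec_decision : Rec 1 (fun e => decision (e 0)).
Proof.
pose f c := ex_minn (decides_exists c).
have rf : Rec 1 (fun e => f (e 0)).
  apply: (@Rec_mu decides).
  - rewrite /decides /root /claim; rec.
    apply: Rec_certificate; rec.
  - by move=> c; rewrite /f; case: ex_minnP.
  - by move=> c k hk; rewrite /f; case: ex_minnP => m _; apply.
apply: (Rec_app2 (h := fun p c => bit p (root c 1))) rf (Rec_var 1 0).
by rewrite /root /claim; rec.
Qed.

Lemma decisionP A : sentence A ->
  (bsat (code A).+1 (code A).+1 (fun=> None) A /\ decision (code A) = 1) \/
  (~ bsat (code A).+1 (code A).+1 (fun=> None) A /\ decision (code A) = 0).
Proof.
move=> sA; rewrite /decision; case: ex_minnP => p /andP[cp hp] _.
have h v := @certificate_formula _ p A _ 0 v cp (leqnn _) (formula_size_code A).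
rewrite env_fun_nil in h.
case: (boolP (bit p (root (code A) 1))) hp => [/h [[_ hA]|[]] // _|_ /= /h [[]|[_ hA]] //].
  by left.
by right.
Qed.

Lemma decidable_by_decision (T : theory) :
  (forall A, sentence A -> T A <-> bsat (code A).+1 (code A).+1 (fun=> None) A) ->
  decidable_theory T.
Proof.
move=> hT; exists (fun v => decision (nth 0 v 0)); first exact: Rec_decision.
move=> A sA; case: (decisionP sA) => -[hA ->]; [left|right]; split=> //.
  exact/hT.
by move/(hT _ sA).
Qed.

Theorem theorem3p3 (R : realType) :
  [/\ completely_axiomatizes axM (real_structure R),
      admits_QE axM,
      admits_QE (Th (real_structure R)),
      decidable_theory (theorems axM)
    & decidable_theory (Th (real_structure R))].
Proof.
have bA A : sentence A -> prv axM A <-> bsat (code A).+1 (code A).+1 (fun=> None) A.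
  by move=> sA; apply: (axM_bsat R sA); apply: formula_size_code.
split.
- exact: axM_complete.
- exact: axM_admits_QE.
- exact: Th_real_admits_QE.
- by apply: decidable_by_decision => A sA; rewrite -bA //; split=> [[]|].
- apply: decidable_by_decision => A sA; rewrite -bA // -(axM_complete R) //.
  by split=> [[]|].
Qed.
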